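(* Let $\mu,\delta\in\mathbb{R}$, $\sigma,\alpha,\theta>0$, let $r$ be a continuously compounded risk-free rate of interest, and let $Y=\{Y_t\}_{t\ge0}$ be a Variance-Gamma process with parameters $(\mu,\delta,\sigma,\alpha,\theta)$, with asset price $S(t)=S(0)e^{Y_t}$, $S(0)>0$. Assume $h_2-h_1>1$ and let $h^*\in(h_1,h_2-1)$ be the Esscher martingale parameter, i.e. $M(h^*+1,1)/M(h^*,1)=e^{r}$. Consider the contingent claim with terminal payoff $(S(0)e^{Y_T}-K)^+$, strike $K>0$ and expiry date $T$. Then at time $t<T$, with $\tau=T-t$, the arbitrage price of the European call option is $$F_{call}(S_t,t)=S(t)\left[1-\hat F\left(\log\tfrac{K}{S(t)},\tau,h^*+1\right)\right]-Ke^{-r\tau}\left[1-\hat F\left(\log\tfrac{K}{S(t)},\tau,h^*\right)\right],$$ where $\hat F(x,\tau,h)=\int_{-\infty}^{x}\hat f(\xi,\tau,h)\,d\xi$. Here $\hat F(\cdot,\tau,h^* )$ and $\hat F(\cdot,\tau,h^*+1)$ are the cumulative distribution functions of the Variance-Gamma laws with parameters $(\tau\mu,\tilde\delta,\sigma,\tau\alpha,\tilde\theta)$ and $(\tau\mu,\tilde\delta+\sigma^2,\sigma,\tau\alpha,\tilde\theta e^{\frac{r-\mu}{\alpha}})$ respectively, where $$\tilde\delta=\delta+h^*\sigma^2,\qquad \tilde\theta=\frac{\theta}{1-\frac12\theta\sigma^2(h^* )^2-\delta\theta h^*}.$$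
   Context: The Variance-Gamma (VG) law with parameters $(m,d,s,a,c)$, $m,d\in\mathbb{R}$, $s,a,c>0$, is the law on $\mathbb{R}$ with characteristic function $\xi\mapsto e^{im\xi}\left(1-i\,d\,c\,\xi+\frac12 s^2c\,\xi^2\right)^{-a}$ (principal branch). A VG process with parameters $(\mu,\delta,\sigma,\alpha,\theta)$ is a Lévy process $Y$ such that $Y_t$ has the VG law with parameters $(t\mu,\delta,\sigma,t\alpha,\theta)$ for every $t>0$; $f(\cdot,t)$ denotes the probability density of $Y_t$, and $\mathcal F_t$ is the natural filtration of $Y$. The moment generating function of $Y_t$ is $$M(h,t)=\frac{e^{t\mu h}}{\left(1-\frac12\theta\sigma^2h^2-\delta\theta h\right)^{t\alpha}},\quad h_1<h<h_2,\qquad h_{1}=-\frac{\delta}{\sigma^2}-\sqrt{\frac{\delta^2}{\sigma^4}+\frac{2}{\theta\sigma^2}},\quad h_{2}=-\frac{\delta}{\sigma^2}+\sqrt{\frac{\delta^2}{\sigma^4}+\frac{2}{\theta\sigma^2}}.$$ For $h_1<h<h_2$ the Esscher-transformed density is $\hat f(x,t,h)=e^{hx}f(x,t)/M(h,t)$. When $h_2-h_1>1$ there is exactly one $h^*\in(h_1,h_2-1)$ with $M(h^*+1,1)/M(h^*,1)=e^{r}$; it defines the equivalent martingale measure $\mathbf Q$ on $\mathcal F_T$ by $d\mathbf Q/d\mathbf P=e^{h^*Y_T}/M(h^*,T)$. The arbitrage price at time $t$ of the claim is by definition $e^{-r\tau}E^{\mathbf Q}\left[(S(0)e^{Y_T}-K)^+\mid\mathcal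 F_t\right]$, $\tau=T-t$. *)

(* Defs.v *)
From HB Require Import structures.
From mathcomp Require Import all_boot all_order all_algebra.
From mathcomp Require Import all_classical all_reals all_analysis.
From mathcomp Require Import measurable_realfun.
From mathcomp.real_closed Require Import complex.

Set Implicit Arguments.
Unset Strict Implicit.
Unset Printing Implicit Defensive.

Import Order.TTheory GRing.Theory Num.Theory.
Import numFieldNormedType.Exports.

Local Open Scope classical_set_scope.
Local Open Scope ring_scope.

Section characteristic_function.
Context {R : realType}.
Local Open Scope complex_scope.

Definition expi (x : R) : R[i] := cos x +i* sin x.

(* Principal argument, with values in ]-pi, pi] for z != 0. *)
Definition Carg (z : R[i]) : R :=
  let r := acos (complex.Re z / Normc.normc z) in
  if 0 <= complex.Im z then r else - r.

(* Principal branch of z ^ p (z != 0). *)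
Definition Cpow (z : R[i]) (p : R) : R[i] :=
  (Normc.normc z `^ p)%:C * expi (p * Carg z).

Definition charfun (V : probability R R) (xi : R) : R[i] :=
  Rintegral V setT (fun x => cos (xi * x))
    +i* Rintegral V setT (fun x => sin (xi * x)).

Definition vg_charfun (m d s a c xi : R) : R[i] :=
  expi (m * xi) *
  Cpow (1 - (d * c * xi)*i + (2^-1 * s ^+ 2 * c * xi ^+ 2)%:C) (- a).

Definition VG_law (m d s a c : R) (V : probability R R) :=
  [/\ 0 < s, 0 < a, 0 < c & forall xi : R, charfun V xi = vg_charfun m d s a c xi].

End characteristic_function.

Section processes.
Context d {Omega : measurableType d} {R : realType} (P : probability Omega R).

(* Events indexed by a subfamily are covered by taking [A i = setT]. *)
Definition mutually_independent n (X : 'I_n -> Omega -> R) : Prop :=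
  forall A : 'I_n -> set R, (forall i, measurable (A i)) ->
    P (\bigcap_i (X i @^-1` A i)) = (\prod_(i < n) P (X i @^-1` A i))%E.

(* The time set is [0, +oo[: [Y t] is ignored for t < 0. *)
Implicit Type Y : R -> {RV P >-> R}.

Definition independent_increments Y : Prop :=
  forall (n : nat) (s : nat -> R),
    0 <= s 0%N -> (forall i, (i < n)%N -> s i < s i.+1) ->
    mutually_independent (fun (i : 'I_n) w => Y (s i.+1) w - Y (s i) w).

Definition stationary_increments Y : Prop :=
  forall (s t : R) (A : set R), 0 <= s -> s < t -> measurable A ->
    P [set w | A (Y t w - Y s w)] = P [set w | A (Y (t - s) w - Y 0 w)].

Definition stochastically_continuous Y : Prop :=
  forall t e : R, 0 <= t -> 0 < e ->
    P [set w | e <= `|Y u w - Y t w|] @[u --> within [set u | 0 <= u] (nbhs t)]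
      --> 0%E.

Definition levy_process Y : Prop :=
  [/\ {ae P, forall w, Y 0 w = 0}, independent_increments Y,
      stationary_increments Y & stochastically_continuous Y].

Definition VG_process (mu delta sigma alpha theta : R) Y : Prop :=
  levy_process Y /\
  forall t : R, 0 < t ->
    VG_law (t * mu) delta sigma (t * alpha) theta (distribution P (Y t)).

Definition density_of (X : {RV P >-> R}) (g : R -> R) : Prop :=
  [/\ measurable_fun setT g, forall x, 0 <= g x &
      forall A : set R, measurable A ->
        distribution P X A = (\int[lebesgue_measure]_(x in A) (g x)%:E)%E].

Definition natural_filtration Y (t : R) : set (set Omega) :=
  <<s \bigcup_(s in [set s | 0 <= s <= t])
        preimage_set_system setT (Y s) measurable >>.

(* [Z] is a version of E^Q[X | G], for a sub-sigma-algebra G. *)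
Definition is_cond_expectation (Q : {measure set Omega -> \bar R})
    (G : set (set Omega)) (X Z : Omega -> R) : Prop :=
  [/\ Q.-integrable setT (EFin \o X), Q.-integrable setT (EFin \o Z),
      forall B : set R, measurable B -> G (Z @^-1` B) &
      forall A, G A ->
        (\int[Q]_(w in A) (Z w)%:E = \int[Q]_(w in A) (X w)%:E)%E].

End processes.

Section esscher.
Context {R : realType}.
Context (mu delta sigma alpha theta : R).

Definition vg_h1 : R :=
  - (delta / sigma ^+ 2)
  - Num.sqrt (delta ^+ 2 / sigma ^+ 4 + 2 / (theta * sigma ^+ 2)).

Definition vg_h2 : R :=
  - (delta / sigma ^+ 2)
  + Num.sqrt (delta ^+ 2 / sigma ^+ 4 + 2 / (theta * sigma ^+ 2)).

Definition vg_mgf (h t : R) : R :=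
  expR (t * mu * h) /
  (1 - 2^-1 * theta * sigma ^+ 2 * h ^+ 2 - delta * theta * h) `^ (t * alpha).

Definition esscher_density (f : R -> R -> R) (x t h : R) : R :=
  expR (h * x) * f x t / vg_mgf h t.

Definition esscher_cdf (f : R -> R -> R) (x t h : R) : R :=
  Rintegral lebesgue_measure `]-oo, x] (fun xi => esscher_density f xi t h).

Context d {Omega : measurableType d} (P : probability Omega R).

(* The measure with P-density e^{h X} / M(h, T), where X plays the role of Y_T.
   It is defined on the whole sigma-algebra of Omega; since the density is
   sigma(X)-measurable, its restriction to F_T has the same density. *)
Definition esscher_measure (X : {RV P >-> R}) (h T : R) (A : set Omega) : \bar R :=
  (\int[P]_(w in A) (expR (h * X w) / vg_mgf h T)%:E)%E.

Section esscher_is_measure.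
Context (X : {RV P >-> R}) (h T : R).

Let dens_ge0 w : (0 <= (expR (h * X w) / vg_mgf h T)%:E)%E.
Proof.
by rewrite lee_fin divr_ge0 ?expR_ge0// divr_ge0 ?expR_ge0 ?powR_ge0.
Qed.

Let measurable_dens :
  measurable_fun setT (EFin \o (fun w => expR (h * X w) / vg_mgf h T)).
Proof.
apply/measurable_EFinP; apply: measurable_funM => //.
by apply: measurableT_comp => //; apply: measurable_funM.
Qed.

Let esscher0 : esscher_measure X h T set0 = 0%E.
Proof. exact: integral_set0. Qed.

Let esscher_ge0 A : (0 <= esscher_measure X h T A)%E.
Proof. exact: integral_ge0. Qed.

Let esscher_sigma_additive : semi_sigma_additive (esscher_measure X h T).
Proof.
move=> F mF tF mUF; rewrite /esscher_measure ge0_integral_bigcup//; last first.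
  exact: measurable_funTS.
by apply: is_cvg_ereal_nneg_natsum_cond => n _ _; exact: integral_ge0.
Qed.

HB.instance Definition _ := isMeasure.Build _ _ _ (esscher_measure X h T)
  esscher0 esscher_ge0 esscher_sigma_additive.

End esscher_is_measure.

Definition is_arbitrage_price (Y : R -> {RV P >-> R}) (r h t T : R)
    (claim price : Omega -> R) : Prop :=
  exists2 Z : Omega -> R,
    is_cond_expectation (esscher_measure (Y T) h T) (natural_filtration Y t)
      claim Z
    & forall w, price w = expR (- (r * (T - t))) * Z w.

End esscher.

(* Main.v *)
(** The Variance-Gamma law is the law of [m + c1 U - c2 V] with [U], [V]
    independent [Gamma(a)] variables and [c1 = 1 / h2], [c2 = - 1 / h1].
    Exponential tilting only rescales a Gamma variable, so Esscher transforms of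
    Variance-Gamma laws are Variance-Gamma laws with the shifted parameters.
    The law of [Y t] is given by its characteristic function; it is identified
    with the law above by the ODE for the Gamma characteristic function, and by
    injectivity of characteristic functions, obtained by smoothing with a Cauchy
    kernel.
    [Y T - Y t] is independent of the past up to [t] by a pi-lambda argument, so
    Fubini reduces the conditional expectation of the payoff to an expectation
    under the tilted law of [Y (T - t)]; the two terms of the price come from the
    tilts at [h + 1] and [h]. *)

Require Import Defs.

From HB Require Import structures.
From mathcomp Require Import all_boot all_order all_algebra.
From mathcomp Require Import all_classical all_reals all_analysis.
From mathcomp Require Import measurable_realfun.
From mathcomp.real_closed Require Import complex.
From mathcomp Require Import ring lra.

Set Implicit Arguments.
Unset Strict Implicit.
Unset Printing Implicit Defensive.

Import Order.TTheory GRing.Theory Num.Theory.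
Import numFieldNormedType.Exports.

Local Open Scope classical_set_scope.
Local Open Scope ring_scope.

(** * Densities and integrals on the half-line *)

(** The law of [Y t] is known only through a characteristic function written with a principal power,
    which does not directly display exponential moments; hence the explicit model. The numbers [c1]
    and [c2] come from the factorisation 1 - d c h - s^2 c h^2 / 2 = (1 - c1 h)(1 + c2 h), whose
    roots are h2 and h1. At h = i xi the same factorisation splits the complex power into two Gamma
    characteristic functions. Every complex identity is handled as a pair of real ones in cosine and
    sine. The Cauchy kernel is convenient for smoothing because both its Fourier integral and its
    mass on an interval have elementary antiderivatives. Tilting identities are stated for
    nonnegative extended-real functions, so that Tonelli applies without integrability checks. The
    martingale equation acts through the quotient q(h) / q(h + 1) of values of the quadratic: it
    yields the factor e^((r - mu) / alpha) of the second law, and also M(h + 1, u) = e^(r u) M(h, u)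
    at every horizon u, which produces the discounting. *)

Section density.
Context d (T : measurableType d) (R : realType).
Local Open Scope ereal_scope.
Import HBNNSimple.

(** Simple functions reduce to the hypothesis on [nu] applied to their level sets, and monotone
    convergence passes to [f]. The density is given pointwise, so the identity holds with [g] itself
    rather than with an almost-everywhere class. *)
Lemma ge0_integral_density (mu nu : {measure set T -> \bar R})
    (g : T -> R) (f : T -> \bar R) (D : set T) :
  measurable_fun setT g -> (forall x, (0 <= g x)%R) ->
  (forall A, measurable A -> nu A = \int[mu]_(x in A) (g x)%:E) ->
  measurable D -> measurable_fun setT f -> (forall x, 0 <= f x) ->
  \int[nu]_(x in D) f x = \int[mu]_(x in D) (f x * (g x)%:E).
Proof.
move=> mg g0 nuE mD mf f0.
wlog -> : D f mD mf f0 / D = setT.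
  move=> hT; have mfD : measurable_fun setT (f \_ D).
    by apply/(measurable_restrictT _ mD); exact: measurable_funTS.
  have fD0 x : 0 <= (f \_ D) x by rewrite patchE; case: ifPn.
  rewrite integral_mkcond (hT setT (f \_ D) measurableT mfD fD0 erefl).
  rewrite [RHS]integral_mkcond.
  by apply: eq_integral => x _; rewrite !patchE; case: ifPn; rewrite ?mul0e.
have mEg : measurable_fun setT (EFin \o g) by exact/measurable_EFinP.
pose h := nnsfun_approx measurableT mf.
have hf x : (h n x)%:E @[n --> \oo] --> f x by exact: cvg_nnsfun_approx.
have ndh x : {homo (fun n => (h n x)%:E) : m n / (m <= n)%N >-> m <= n}.
  by move=> m n mn; rewrite lee_fin; exact/lefP/nd_nnsfun_approx.
have mh n : measurable_fun setT (fun x => (h n x)%:E).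
  exact/measurable_EFinP.
have hE n : \int[nu]_x (h n x)%:E = \int[mu]_x ((h n x)%:E * (g x)%:E).
  rewrite integral_nnsfun// patch_setT sintegralE.
  have mi0 (y : R) x : 0 <= (y * \1_(h n @^-1` [set y]) x)%:E.
    by rewrite EFinM nnfun_muleindic_ge0.
  under [RHS]eq_integral => x _.
    rewrite fimfunE -fsumEFin// ge0_mule_fsuml; last by move=> y; exact: mi0.
    over.
  rewrite ge0_integral_fsum//; last 2 first.
  - move=> y; apply: emeasurable_funM => //.
    by apply/measurable_EFinP; exact: measurable_funM.
  - by move=> y x _; rewrite mule_ge0// lee_fin.
  apply: eq_fsbigr => y /[!inE] -[x _ <-].
  have mA : measurable (h n @^-1` [set h n x]) by exact: measurable_sfunP.
  rewrite nuE// integral_mkcond -ge0_integralZl//; last 3 first.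
  - by apply: (measurable_restrictT (EFin \o g) mA).1; exact: measurable_funTS.
  - by move=> z _; rewrite patchE; case: ifPn => // _; rewrite lee_fin.
  - by rewrite lee_fin.
  apply: eq_integral => z _; rewrite patchE indicE EFinM -muleA.
  by case: ifPn; rewrite ?mul1e ?mul0e.
transitivity (limn (fun n => \int[nu]_x (h n x)%:E)).
  rewrite -monotone_convergence//.
  - by apply: eq_integral => x _; apply/esym/cvg_lim => //; exact: hf.
  - by move=> n x _; rewrite lee_fin.
under eq_fun do rewrite hE.
rewrite -monotone_convergence//.
- apply: eq_integral => x _; apply/cvg_lim => //.
  by apply: cvgeZr => //; exact: hf.
- by move=> n; exact: emeasurable_funM.
- by move=> n x _; rewrite mule_ge0// lee_fin.
- by move=> x _ m n mn; rewrite lee_wpmul2r ?lee_fin// -lee_fin; exact: ndh.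
Qed.

Lemma density_probability (mu : {measure set T -> \bar R}) (g : T -> R) :
  measurable_fun setT g -> (forall x, (0 <= g x)%R) ->
  \int[mu]_x (g x)%:E = 1 ->
  exists Q : probability T R,
    forall A, measurable A -> Q A = \int[mu]_(x in A) (g x)%:E.
Proof.
move=> mg g0 g1.
pose q (A : set T) := \int[mu]_(x in A) (g x)%:E.
have q0 : q set0 = 0 by exact: integral_set0.
have q_ge0 A : 0 <= q A by apply: integral_ge0 => x _; rewrite lee_fin.
have q_sigma : semi_sigma_additive q.
  move=> F mF tF mUF; rewrite /q ge0_integral_bigcup//.
  - apply: is_cvg_ereal_nneg_natsum_cond => n _ _; exact: q_ge0.
  - by apply/measurable_funTS/measurable_EFinP.
  - by move=> x _; rewrite lee_fin.
pose mq := isMeasure.Build _ _ _ q q0 q_ge0 q_sigma.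
pose qm : {measure set T -> \bar R} := HB.pack q mq.
pose pq := Measure_isProbability.Build _ _ _ qm g1.
pose Q : probability T R := HB.pack q mq pq.
by exists Q.
Qed.

End density.

Section lebesgue_density.
Context (R : realType).
Notation leb := (@lebesgue_measure R).
Local Open Scope ereal_scope.

(* [lebesgue_measure] lives on [measurableTypeR R], whose display differs from
   the one of the canonical structure of [R]. *)
Let idR : R -> measurableTypeR R := idfun.

Let midR : measurable_fun setT idR.
Proof. by move=> _ A mA; rewrite setTI. Qed.

Section integral.
Variables (nu : {measure set R -> \bar R}) (g : R -> R).
Hypotheses (mg : measurable_fun setT g) (g0 : forall x, (0 <= g x)%R).
Hypothesis nuE :
  forall A, measurable A -> nu A = \int[leb]_(x in A) (g x)%:E.

Lemma ge0_integral_lebesgue_density (f : R -> \bar R) (D : set R) :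
  measurable D -> measurable_fun setT f -> (forall x, 0 <= f x) ->
  \int[nu]_(x in D) f x = \int[leb]_(x in D) (f x * (g x)%:E).
Proof.
move=> mD mf f0.
(* The image of [nu] under the identity lives on the display of Lebesgue measure, where the general
   lemma applies. *)
pose pid_ : {measure set (measurableTypeR R) -> \bar R} := pushforward nu idR.
pose pid := pid_ midR.
rewrite -(@ge0_integral_density _ (measurableTypeR R) R leb pid g f D)//.
by rewrite [RHS]ge0_integral_pushforward//; exact: measurable_funTS.
Qed.

(** Multiplication by [g >= 0] commutes with positive and negative parts, so both sides are the same
    difference of nonnegative integrals. *)
Lemma integral_lebesgue_density (f : R -> \bar R) (D : set R) :
  measurable D -> measurable_fun setT f ->
  \int[nu]_(x in D) f x = \int[leb]_(x in D) (f x * (g x)%:E).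
Proof.
move=> mD mf; rewrite [LHS]integralE [RHS]integralE.
rewrite !ge0_integral_lebesgue_density//.
- congr (_ - _); apply: eq_integral => x _.
    by rewrite !funeposE maxe_pMl ?lee_fin// mul0e.
  by rewrite !funenegE maxe_pMl ?lee_fin// mul0e mulNe.
- exact: measurable_funeneg.
- exact: measurable_funepos.
Qed.

End integral.

Lemma lebesgue_density_probability (g : R -> R) :
  measurable_fun setT g -> (forall x, (0 <= g x)%R) ->
  \int[leb]_x (g x)%:E = 1 ->
  exists Q : probability R R,
    forall A, measurable A -> Q A = \int[leb]_(x in A) (g x)%:E.
Proof.
move=> mg g0 g1.
have [Q0 Q0E] := @density_probability _ (measurableTypeR R) R leb g mg g0 g1.
have mRid : measurable_fun setT (idfun : measurableTypeR R -> R) by [].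
pose mid := isMeasurableFun.Build _ _ (measurableTypeR R) R idfun mRid.
pose Rid : {mfun measurableTypeR R >-> R} := HB.pack idfun mid.
by exists (distribution Q0 Rid).
Qed.

End lebesgue_density.

Section lebesgue_scaling.
Context (R : realType).
Notation leb := (@lebesgue_measure R).
Local Open Scope ereal_scope.

(** By uniqueness of Lebesgue measure: [c] times its image under x -> c x gives every interval ]a,
    b] its length. *)
Lemma ge0_integral_lebesgue_scale (c : R) (f : R -> \bar R) : (0 < c)%R ->
  measurable_fun setT f -> (forall x, 0 <= f x) ->
  \int[leb]_x f x = c%:E * \int[leb]_x f (c * x)%R.
Proof.
move=> c0 mf f0.
have mc : measurable_fun setT (fun x : R => c * x)%R by exact: measurable_funM.
pose phi (x : measurableTypeR R) : measurableTypeR R := (c * x)%R.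
have mphi : measurable_fun setT phi by [].
pose m_ : {measure set (measurableTypeR R) -> \bar R} :=
  mscale (NngNum (ltW c0)) (pushforward leb phi).
pose m := m_ mphi.
have mE A : measurable A -> leb A = m A.
  apply: lebesgue_measure_unique => _ [[a b] _ <-]/=.
  rewrite /m /mscale/= /pushforward.
  have -> : (fun x : R => c * x)%R @^-1` `]a, b] = `](a / c)%R, (b / c)%R]%classic.
    by apply/seteqP; split=> x /=; rewrite !in_itv/= ltr_pdivrMr// ler_pdivlMr// ![(x * c)%R]mulrC.
  rewrite !lebesgue_measure_itv/= !lte_fin ltr_pM2r ?invr_gt0//.
  case: ifPn => _; last by rewrite mule0.
  by rewrite -!EFinB -EFinM; congr EFin; field; rewrite gt_eqF.
rewrite (eq_measure_integral m)//; last by move=> A mA _; exact: mE.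
rewrite ge0_integral_mscale//; congr (_ * _).
by rewrite ge0_integral_pushforward//.
Qed.

End lebesgue_scaling.

(** * Fundamental theorem of calculus on the open half-line *)

Section FTC_itv0y.
Context (R : realType).
Notation leb := (@lebesgue_measure R).

(** Integrands may blow up at 0, so the half-line is exhausted from both ends. The left end 1/(n+2),
    instead of 1/(n+1), keeps [J 0] = [1/2, 1] nondegenerate, as the theorem on a compact interval
    requires. *)
Let J n : set R := `[n.+2%:R^-1, n.+1%:R].

Let bigcupJ : \bigcup_n J n = `]0, +oo[%classic.
Proof.
apply/seteqP; split => x /=.
  move=> [n _]; rewrite /J/= !in_itv/= andbT => /andP[+ _].
  by apply: lt_le_trans; rewrite invr_gt0.
rewrite in_itv/= andbT => x0.
exists (maxn (Num.truncn x) (Num.truncn x^-1)) => //; rewrite /J/= in_itv/=.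
apply/andP; split.
  rewrite invf_ple ?posrE// (le_trans (ltW (truncnS_gt _)))// ler_nat.
  by rewrite ltnS (leq_trans _ (leqnSn _))// leq_maxr.
by rewrite (le_trans (ltW (truncnS_gt _)))// ler_nat ltnS leq_maxl.
Qed.

Let ndJ : nondecreasing_seq J.
Proof.
move=> m n mn; apply/subsetPset => x; rewrite /J/= !in_itv/= => /andP[mx xm].
rewrite (le_trans _ mx) ?(le_trans xm) ?ler_nat//.
by rewrite lef_pV2 ?posrE// ler_nat.
Qed.

Let FTC_J (f F : R -> R) n :
  (forall x : R, 0 < x -> is_derive x 1 F (f x)) ->
  (forall x : R, 0 < x -> {for x, continuous f}) ->
  (\int[leb]_(x in J n) (f x)%:E)%E = (F n.+1%:R - F n.+2%:R^-1)%:E.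
Proof.
move=> dF cf; rewrite /J.
have n0 : 0 < n.+2%:R^-1 :> R by rewrite invr_gt0.
have lt1 : n.+2%:R^-1 < n.+1%:R :> R.
  by rewrite (@lt_le_trans _ _ 1) ?ler1n// invf_lt1 ?ltr1n.
have dF' (x : R) : 0 < x -> derivable F x 1 by move=> /dF[].
rewrite (@continuous_FTC2 _ f F)//.
- apply: continuous_in_subspaceT => x /[!inE]/= /[!in_itv]/= /andP[nx _].
  exact/cf/(lt_le_trans n0).
- split.
  + by move=> x; rewrite in_itv/= => /andP[nx _]; apply/dF'/(lt_trans n0).
  + apply: cvg_at_right_filter.
    by apply: differentiable_continuous; apply/derivable1_diffP/dF'.
  + apply: cvg_at_left_filter.
    by apply: differentiable_continuous; apply/derivable1_diffP/dF'.
- move=> x; rewrite in_itv/= => /andP[nx _].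
  by rewrite derive1E; have [_] := dF _ (lt_trans n0 nx).
Qed.

(** A practical integrability test: the integrals over [J n] increase to the full one, and each is a
    difference of two values of [F], hence at most [M + M]. *)
Lemma ge0_integrable_itv0y_FTC (f F : R -> R) (M : R) :
  (forall x : R, 0 < x -> 0 <= f x) ->
  (forall x : R, 0 < x -> is_derive x 1 F (f x)) ->
  (forall x : R, 0 < x -> {for x, continuous f}) ->
  (forall x : R, 0 < x -> `|F x| <= M) ->
  leb.-integrable `]0, +oo[ (EFin \o f).
Proof.
move=> f0 dF cf FM.
have mf : measurable_fun (`]0, +oo[%classic : set R) (EFin \o f).
  apply/measurable_EFinP; apply: open_continuous_measurable_fun => //.
  by move=> x /[!inE]/= /[!in_itv]/= /andP[? _]; exact: cf.
have hcv : (\int[leb]_(x in J n) (f x)%:E)%E @[n --> \oo] -->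
    (\int[leb]_(x in `]0%R, +oo[) (f x)%:E)%E.
  rewrite -bigcupJ.
  apply: (@ge0_nondecreasing_set_cvg_integral _ (measurableTypeR R) R J
    (EFin \o f) leb) => //.
  - by move=> n; exact: measurable_itv.
  - move=> n; apply: (measurable_funS _ _ mf) => //.
    by move=> x Jx; rewrite -bigcupJ; exists n.
  - move=> n x; rewrite /J/= in_itv/= => /andP[nx _].
    by rewrite lee_fin f0// (lt_le_trans _ nx)// invr_gt0.
apply/integrableP; split => //.
have -> : (\int[leb]_(x in `]0%R, +oo[) `|(EFin \o f) x| =
    \int[leb]_(x in `]0%R, +oo[) (f x)%:E)%E.
  apply: eq_integral => x /[!inE]/= /[!in_itv]/= /andP[x0 _].
  by rewrite ger0_norm ?f0.
have le2M n : ((\int[leb]_(x in J n) (f x)%:E) <= (M + M)%:E)%E.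
  rewrite (FTC_J _ dF cf) lee_fin lerD//.
    by rewrite (le_trans (ler_norm _))// FM.
  by rewrite (le_trans (ler_norm _))// normrN FM// invr_gt0.
rewrite -(cvg_lim _ hcv)// (@le_lt_trans _ _ (M + M)%:E) ?ltry//.
by apply: lime_le; [apply/cvg_ex; eexists; exact: hcv|exact: nearW].
Qed.

(** Dominated convergence along [J n], with |f| as dominating function. Integrability is a separate
    input because limits of [F] alone give only an improper integral. *)
Lemma integral_itv0y_FTC (f F : R -> R) (l0 l1 : R) :
  leb.-integrable `]0, +oo[ (EFin \o f) ->
  (forall x : R, 0 < x -> is_derive x 1 F (f x)) ->
  (forall x : R, 0 < x -> {for x, continuous f}) ->
  F (n.+1%:R^-1 : R) @[n --> \oo] --> l0 -> F (n.+1%:R : R) @[n --> \oo] --> l1 ->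
  (\int[leb]_(x in `]0%R, +oo[) (f x)%:E = (l1 - l0)%:E)%E.
Proof.
move=> intf dF cf F0 F1.
have : (\int[leb]_(x in J n) (f x)%:E)%E @[n --> \oo] --> (l1 - l0)%:E.
  under eq_fun do rewrite (FTC_J _ dF cf).
  apply: cvg_EFin; first exact: nearW.
  by apply: cvgB => //; rewrite (cvg_shiftS (fun n => F (n.+1%:R^-1 : R))).
move=> /(cvg_unique _) h2; apply/esym/h2 => //.
rewrite integral_mkcond.
have -> : (fun n => \int[leb]_(x in J n) (f x)%:E)%E =
    (fun n => \int[leb]_x ((EFin \o f) \_ (J n)) x)%E.
  by apply/funext => n; rewrite integral_mkcond.
have Jsub n x : J n x -> `]0, +oo[%classic x.
  by rewrite -bigcupJ => ?; exists n.
apply: (@dominated_cvg _ (measurableTypeR R) R leb setT _ _ _ (abse \o ((EFin \o f) \_ `]0, +oo[))) => //.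
- move=> n; have mJ : measurable (J n) by exact: measurable_itv.
  apply: (measurable_restrictT (EFin \o f) mJ).1.
  apply: (measurable_funS _ _ (measurable_int _ intf)) => //.
  exact: Jsub.
- move=> x _; apply: cvg_near_cst.
  have [x0|x0] := boolP (x \in `]0, +oo[%classic).
    have : (\bigcup_n J n) x by rewrite bigcupJ; exact/set_mem.
    move=> [N _ JNx]; exists N => // n /= Nn.
    have Jnx : J n x by have /subsetPset := ndJ Nn; exact.
    by rewrite !patchE x0 (mem_set Jnx).
  apply: nearW => n; rewrite !patchE !memNset//.
    by move=> /mem_set; apply/negP.
  by move=> /Jsub/mem_set; apply/negP.
- by move=> x _; rewrite /= patchE; case: ifPn.
- apply: integrable_abse; rewrite -integrable_mkcond//; exact: measurable_itv.
- move=> n x _; rewrite [leRHS]/= !patchE; case: ifPn => [/set_mem/Jsub xx|_].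
    by rewrite mem_set.
  by rewrite abse0 abse_ge0.
Qed.

End FTC_itv0y.

(** * The Gamma law *)

Section gamma.
Context (R : realType).
Notation leb := (@lebesgue_measure R).
Implicit Types (a x y eta : R).

Let mI : measurable (`]0, +oo[%classic : set (measurableTypeR R)).
Proof. exact: measurable_itv. Qed.

Definition gamma_fun a x : R := x `^ (a - 1) * expR (- x).

(** From 1 + y <= e^y at y = ln (x / a), multiplied by a. The bound is cruder than the optimal (a /
    e)^a e^x but suffices for every tail estimate. *)
Lemma powR_le_expR a x : 0 < a -> 0 < x -> x `^ a <= a `^ a * expR x.
Proof.
move=> a0 x0; rewrite /powR !gt_eqF// -expRD ler_expR.
have := expR_ge1Dx (ln (x / a)); rewrite lnK ?posrE ?divr_gt0//.
rewrite ln_div ?posrE// ler_pdivlMr// => h.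
suff : a * (1 + (ln x - ln a)) <= x by lra.
by rewrite mulrC.
Qed.

Lemma continuous_gamma_fun a x : 0 < x -> {for x, continuous (gamma_fun a)}.
Proof.
move=> x0; apply: differentiable_continuous; apply/derivable1_diffP.
apply: derivableM; first by apply: derivable_powR; rewrite in_itv/= x0.
by apply: ex_derive.
Qed.

Lemma gamma_fun_gt0 a x : 0 < x -> 0 < gamma_fun a x.
Proof. by move=> x0; rewrite mulr_gt0 ?powR_gt0 ?expR_gt0. Qed.

Lemma gamma_fun_ge0 a x : 0 <= gamma_fun a x.
Proof. by rewrite mulr_ge0 ?powR_ge0 ?expR_ge0. Qed.

Lemma measurable_gamma_fun a : measurable_fun setT (gamma_fun a).
Proof.
apply: measurable_funM; first exact: measurable_powR.
by apply: measurableT_comp => //; exact: measurable_funN.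
Qed.

Lemma gamma_funS a x : 0 < x -> gamma_fun (a + 1) x = x * gamma_fun a x.
Proof.
move=> x0; rewrite /gamma_fun addrK mulrA; congr (_ * _).
rewrite -{1}(subrK 1 a) (@powRD _ x (a - 1) 1); last first.
  by rewrite (gt_eqF x0) implybT.
by rewrite powRr1 ?ltW// mulrC.
Qed.

(** Comparison with a x^(a-1) / (1 + x^a)^2, the derivative of the bounded function -1 / (1 + x^a).
    It has the right singularity at 0 when a < 1 and decays at infinity, so one comparison serves
    both ends. *)
Lemma integrable_gamma_fun a : 0 < a ->
  leb.-integrable `]0, +oo[ (EFin \o gamma_fun a).
Proof.
move=> a0.
pose D := cst 1 + @powR R ^~ a.
pose F := (fun x => - (D x)^-1).
pose f := (fun x => a * x `^ (a - 1) / D x ^+ 2).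
have D0 x : 0 < D x by rewrite /D/= ltr_pwDl ?powR_ge0.
have dD x : 0 < x -> is_derive x 1 D (0 + a * x `^ (a - 1)).
  by move=> x0; apply: is_deriveD; exact: is_derive1_powR.
(* With p = x^a: (1 + p)^2 <= 2 (1 + p^2), and both 1 <= e^x and p^2 = x^(2a) <= (2a)^(2a) e^x.
   Hence (1 + p)^2 e^(-x) <= 2 (1 + (2a)^(2a)); the division by a cancels the factor a of [f]. *)
pose K := 2 * (1 + (a + a) `^ (a + a)) / a.
have f0 x : 0 < x -> 0 <= f x.
  by move=> x0; rewrite /f divr_ge0 ?mulr_ge0 ?powR_ge0 ?(ltW a0)// ltW.
have K0 : 0 <= K by rewrite !mulr_ge0 ?invr_ge0 ?(ltW a0) ?addr_ge0 ?powR_ge0.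
have intf : leb.-integrable `]0, +oo[ (EFin \o f).
  apply: (@ge0_integrable_itv0y_FTC _ _ F 1).
  - exact: f0.
  - move=> x x0; rewrite /F.
    have dV := is_deriveV (lt0r_neq0 (D0 x)) (dD x x0).
    have dN := is_deriveN dV; apply: (is_derive_eq dN).
    by rewrite /f add0r scaleNr opprK /= [RHS]mulrC.
  - move=> x x0; apply: differentiable_continuous; apply/derivable1_diffP.
    have dp b : derivable (@powR R ^~ b) x 1.
      by apply: derivable_powR; rewrite in_itv/= x0.
    apply: derivableM; first by apply: derivableM.
    apply: derivableV; first by rewrite expf_neq0// gt_eqF.
    by apply: (@derivableX _ _ D 2); have [] := dD x x0.
  - move=> x x0; rewrite /F normrN ger0_norm ?invr_ge0 ?(ltW (D0 x))//.
    by rewrite invf_le1// /D/= lerDl powR_ge0.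
apply: (@le_integrable _ _ _ leb `]0, +oo[ _ _ (fun x => (K * f x)%:E)) => //.
- by apply/measurable_EFinP/measurable_funTS; exact: measurable_gamma_fun.
- move=> x; rewrite /= in_itv/= andbT => x0.
  rewrite lee_fin (ger0_norm (gamma_fun_ge0 a x)).
  rewrite (ger0_norm (mulr_ge0 K0 (f0 x x0))).
  rewrite /K /f /gamma_fun.
  have -> : 2 * (1 + (a + a) `^ (a + a)) / a * (a * x `^ (a - 1) / D x ^+ 2) =
      x `^ (a - 1) * (2 * (1 + (a + a) `^ (a + a)) / D x ^+ 2).
    by field; rewrite !gt_eqF// ?D0.
  rewrite ler_pM2l ?powR_gt0// expRN ler_pdivlMr ?exprn_gt0// mulrC.
  rewrite ler_pdivrMr ?expR_gt0//.
  have hE := @powR_le_expR (a + a) x (addr_gt0 a0 a0) x0.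
  have h1 : 1 <= expR x by rewrite -expR0 ler_expR ltW.
  have : x `^ (a + a) = x `^ a * x `^ a by rewrite powRD// (gt_eqF x0) implybT.
  have -> : D x = 1 + x `^ a by [].
  move=> h2; rewrite h2 in hE.
  have : 0 <= (1 - x `^ a) ^+ 2 by exact: sqr_ge0.
  move: (x `^ a) ((a + a) `^ (a + a)) (expR x) hE h1 => p q e; nra.
- have := integrableZl mI K intf.
  by apply: eq_integrable => // x _; rewrite /= EFinM.
Qed.

Lemma integrable_gamma_funM a (r : R -> R) (N : R) : 0 < a ->
  measurable_fun setT r -> (forall x, `|r x| <= N) ->
  leb.-integrable `]0, +oo[ (EFin \o (fun x => gamma_fun a x * r x)).
Proof.
move=> a0 mr rN.
apply: (@le_integrable _ _ _ leb `]0, +oo[ _ _ (fun x => (N * gamma_fun a x)%:E)) => //.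
- apply/measurable_EFinP/measurable_funTS; apply: measurable_funM => //.
  exact: measurable_gamma_fun.
- move=> x _; rewrite /= lee_fin !normrM [leLHS]mulrC ler_wpM2r//.
  by rewrite (le_trans (rN x))// ler_norm.
- have := integrableZl mI N (integrable_gamma_fun a0).
  by apply: eq_integrable => // x _; rewrite /= EFinM.
Qed.

(** The derivative of x^a e^(-x) s(x) integrates to 0, since that function vanishes at 0 (as a > 0)
    and at infinity. For s = 1 this is the functional equation of Euler's Gamma. *)
Lemma gamma_ibp a (s s' : R -> R) (M : R) : 0 < a ->
  (forall x, is_derive x 1 s (s' x)) -> continuous s' ->
  (forall x, `|s x| <= 1) -> (forall x, `|s' x| <= M) ->
  (\int[leb]_(x in `]0%R, +oo[) (gamma_fun (a + 1) x * s x) =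
   a * \int[leb]_(x in `]0%R, +oo[) (gamma_fun a x * s x) +
   \int[leb]_(x in `]0%R, +oo[) (gamma_fun (a + 1) x * s' x))%R.
Proof.
move=> a0 ds cs' s1 s'M.
have cs : continuous s.
  move=> x; apply: differentiable_continuous; apply/derivable1_diffP.
  by have [] := ds x.
have ms : measurable_fun setT s by exact: continuous_measurable_fun.
have ms' : measurable_fun setT s' by exact: continuous_measurable_fun.
have a10 : 0 < a + 1 by rewrite addr_gt0.
have igs := @integrable_gamma_funM.
pose F := (@powR R ^~ a) * (expR \o -%R) * s.
pose f x := a * (gamma_fun a x * s x) - gamma_fun (a + 1) x * s x
            + gamma_fun (a + 1) x * s' x.
have i1 := igs _ _ _ a0 ms s1.
have i2 := igs _ _ _ a10 ms s1.
have i3 := igs _ _ _ a10 ms' s'M.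
have i1a : leb.-integrable `]0, +oo[ (EFin \o (fun x => a * (gamma_fun a x * s x))).
  have := integrableZl mI a i1.
  by apply: eq_integrable => // x _; rewrite /= EFinM.
have i12 : leb.-integrable `]0, +oo[ (EFin \o (fun x => a * (gamma_fun a x * s x) - gamma_fun (a + 1) x * s x)).
  have := integrableB mI i1a i2.
  by apply: eq_integrable => // x _; rewrite /= EFinB.
have intf : leb.-integrable `]0, +oo[ (EFin \o f).
  have := integrableD mI i12 i3.
  by apply: eq_integrable => // x _; rewrite /= EFinD.
have Fb x : 0 < x -> `|F x| <= x `^ a * expR (- x).
  move=> x0; rewrite /F normrM /= ger0_norm ?mulr_ge0 ?powR_ge0 ?expR_ge0//.
  by rewrite ler_piMr// mulr_ge0 ?powR_ge0 ?expR_ge0.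
have : (\int[leb]_(x in `]0%R, +oo[) (f x)%:E = (0 - 0)%:E)%E.
  apply: (@integral_itv0y_FTC _ _ F) => //.
  - move=> x x0; rewrite /F.
    have dp := is_derive1_powR a x0; have dsx := ds x.
    apply: is_derive_eq.
    have -> : (@powR R ^~ a * (expR \o -%R)) x = x `^ a * expR (- x) by [].
    by rewrite /f /gamma_fun addrK /= /GRing.scale/=; ring.
  - move=> x x0.
    apply: cvgD; last by apply: cvgM; [exact: continuous_gamma_fun|exact: cs'].
    apply: cvgB; last by apply: cvgM; [exact: continuous_gamma_fun|exact: cs].
    apply: cvgM; first exact: cvg_cst.
    by apply: cvgM; [exact: continuous_gamma_fun|exact: cs].
  - apply/cvgr0Pnorm_le => e e0.
    have : (n.+1%:R^-1 : R) `^ a @[n --> \oo] --> (0 : R).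
      apply: (cvg_at_rightP (@powR R ^~ a) 0 0).1; first exact: powR_cvg0.
      by split => [n|]; [rewrite invr_gt0|exact: cvg_harmonic].
    move=> /cvgr0Pnorm_le /(_ e e0); apply: filterS => n /=.
    rewrite ger0_norm ?powR_ge0//; apply: le_trans.
    have n0 : 0 < n.+1%:R^-1 :> R by rewrite invr_gt0.
    apply: (le_trans (Fb _ n0)); rewrite ler_piMr ?powR_ge0//.
  - apply: norm_cvg0.
    (* The exponential bound is used with exponent a + 1, one more than the power at hand, to gain a
       factor 1/x: x^a e^(-x) <= K / x. *)
    pose K := (a + 1) `^ (a + 1).
    apply: (@squeeze_cvgr _ _ _ _ (cst 0) (fun n => K * n.+1%:R^-1)); last 2 first.
    + exact: cvg_cst.
    + by rewrite -[X in _ --> X](mulr0 K); apply: cvgM; [exact: cvg_cst|exact: cvg_harmonic].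
    apply: nearW => n; rewrite normr_ge0/= (le_trans (Fb _ _))//.
    have n0 : 0 < n.+1%:R :> R by [].
    have := powR_le_expR a10 n0.
    rewrite (@powRD _ _ a 1) ?(gt_eqF n0) ?implybT//.
    rewrite (powRr1 (ltW n0)) -/K => h.
    have en := expR_gt0 (n.+1%:R : R).
    by rewrite expRN (ler_pdivrMr _ _ en) mulrAC (ler_pdivlMr _ _ n0).
move=> If; have {If} : (\int[leb]_(x in `]0%R, +oo[) f x = 0)%R.
  by rewrite /Rintegral If subrr.
rewrite /f RintegralD//.
rewrite RintegralB//.
rewrite RintegralZl//.
by move=> /eqP; rewrite addrAC subr_eq0 => /eqP <-.
Qed.

(** Differentiating in z brings out a factor u, which raises the exponent of the weight by one; that
    weight dominates uniformly in z because |s'| <= 1. *)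
Lemma is_derive_gamma_integral a (s s' : R -> R) eta : 0 < a ->
  (forall x, is_derive x 1 s (s' x)) -> continuous s' ->
  (forall x, `|s x| <= 1) -> (forall x, `|s' x| <= 1) ->
  is_derive eta 1
    (fun z => \int[leb]_(u in `]0%R, +oo[) (gamma_fun a u * s (z * u)))
    (\int[leb]_(u in `]0%R, +oo[) (gamma_fun (a + 1) u * s' (eta * u))).
Proof.
move=> a0 ds cs' s1 s'1.
have cs : continuous s.
  move=> x; apply: differentiable_continuous; apply/derivable1_diffP.
  by have [] := ds x.
have ms : measurable_fun setT s by exact: continuous_measurable_fun.
pose f z u := gamma_fun a u * s (z * u).
have df (z u : R) : is_derive z 1 (f ^~ u) (gamma_fun a u * (s' (z * u) * u)).
  have dm : is_derive z 1 ( *%R^~ u : R -> R) u.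
    have := @is_deriveM _ _ (@id R) (cst u) z 1 1 0 _ _.
    move=> /(_ _ _)/is_derive_eq; apply.
    by rewrite scaler0 add0r /GRing.scale/= mulr1.
  have dc := @is_derive1_comp _ s ( *%R^~ u) z _ _ (ds (z * u)) dm.
  exact: (is_deriveZ (gamma_fun a u) dc).
have pf (z u : R) : partial1of2 f z u = gamma_fun a u * (s' (z * u) * u).
  by rewrite partial1of2E; have [] := df z u.
have I0 : `](eta - 1), (eta + 1)[%classic eta.
  by rewrite /= in_itv/= ltrBlDr ltrDl ltr01.
have intf z : leb.-integrable `]0, +oo[ (EFin \o f z).
  apply: (@integrable_gamma_funM _ _ 1) => //.
  by apply: measurableT_comp => //; exact: measurable_funM.
have a10 : 0 < a + 1 by rewrite addr_gt0.
have pfle z u : (`]0, +oo[%classic : set R) u ->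
    `|partial1of2 f z u| <= gamma_fun (a + 1) u.
  rewrite /= in_itv/= andbT => u0; rewrite pf gamma_funS//.
  move: (gamma_fun a u) (gamma_fun_ge0 a u) => g g0.
  rewrite !normrM (ger0_norm g0) (gtr0_norm u0).
  by rewrite mulrCA [leRHS]mulrC ler_piMl// mulr_ge0// ltW.
have der := derivable_under_integral mI I0 (fun z _ => intf z)
  (fun z u _ _ => @ex_derive _ _ _ _ _ _ _ (df z u))
  (gamma_fun_ge0 (a + 1)) (integrable_gamma_fun a10) (fun z u _ => @pfle z u).
have derE := differentiation_under_integral mI I0 (fun z _ => intf z)
  (fun z u _ _ => @ex_derive _ _ _ _ _ _ _ (df z u))
  (gamma_fun_ge0 (a + 1)) (integrable_gamma_fun a10) (fun z u _ => @pfle z u).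
apply: DeriveDef; first exact: der.
rewrite -derive1E derE; apply: eq_Rintegral => u.
rewrite inE/= in_itv/= andbT => u0.
by rewrite pf gamma_funS//; ring.
Qed.

(** Euler's Gamma function at [a], the normalising constant of the density. *)
Definition gamma_const a : R := \int[leb]_(u in `]0%R, +oo[) gamma_fun a u.

(** Otherwise the positive integrand would vanish almost everywhere and ]0, +oo[ would be a null
    set. *)
Lemma gamma_const_gt0 a : 0 < a -> 0 < gamma_const a.
Proof.
move=> a0; rewrite lt_neqAle; apply/andP; split; last first.
  by apply: Rintegral_ge0 => u _; exact: gamma_fun_ge0.
apply/eqP => G0.
have ig := integrable_gamma_fun a0.
have : (\int[leb]_(x in `]0%R, +oo[) `|(EFin \o gamma_fun a) x| = 0)%E.
  under eq_integral => u _ do rewrite /= ger0_norm ?gamma_fun_ge0//.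
  have := integrable_fin_num mI ig => /fineK <-.
  by rewrite -[LHS]/((gamma_const a)%:E) -G0.
move=> /(ae_eq_integral_abs leb mI (measurable_int _ ig)) [N [mN N0 sN]].
have : (leb (`]0%R, +oo[%classic : set R) <= leb N)%E.
  apply: le_measure; rewrite ?inE//.
  move=> u u0; apply: sN => /= /(_ u0) [].
  by apply/eqP; rewrite gt_eqF// gamma_fun_gt0//; move: u0; rewrite /= in_itv/= andbT.
by rewrite N0 lebesgue_measure_itv/= ltry.
Qed.

(* The integral I(z) of u^(a-1) e^(-u) e^(i z u) satisfies
   (1 - i z) I'(z) = i a I(z) by parts, hence I(z) = I(0) (1 - i z)^(-a). *)
Lemma gamma_charfun a eta : 0 < a ->
  let rho := gamma_const a * (1 + eta ^+ 2) `^ (- (a / 2)) in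
  \int[leb]_(u in `]0%R, +oo[) (gamma_fun a u * cos (eta * u)) =
    rho * cos (a * atan eta) /\
  \int[leb]_(u in `]0%R, +oo[) (gamma_fun a u * sin (eta * u)) =
    rho * sin (a * atan eta).
Proof.
move=> a0 rho.
(* For s = cos and s = sin these are the real and imaginary parts of I_b(z), the integral of u^(b-1)
   e^(-u) e^(i z u). *)
pose K b (s : R -> R) z := \int[leb]_(u in `]0%R, +oo[) (gamma_fun b u * s (z * u)).
have KN b s z : 0 < b -> continuous s -> (forall x, `|s x| <= 1) ->
    K b (fun x => - s x) z = - K b s z.
  move=> b0 cs s1; rewrite /K -mulN1r -RintegralZl//; last first.
    apply: (@integrable_gamma_funM _ _ 1) => //.
    apply: measurableT_comp; last exact: measurable_funM.
    exact: continuous_measurable_fun.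
  by apply: eq_Rintegral => u _; rewrite mulN1r mulrN.
have cos1 (x : R) : `|cos x| <= 1 by rewrite ler_norml cos_geN1 cos_le1.
have sin1 (x : R) : `|sin x| <= 1 by rewrite ler_norml sin_geN1 sin_le1.
have a10 : 0 < a + 1 by rewrite addr_gt0.
have dC (z : R) : is_derive z 1 (K a cos) (- K (a + 1) sin z).
  rewrite -KN//; last exact: continuous_sin.
  apply: is_derive_gamma_integral => //.
  - by move=> x; apply: cvgN; exact: continuous_sin.
  - by move=> x; rewrite normrN.
have dS (z : R) : is_derive z 1 (K a sin) (K (a + 1) cos z).
  by apply: is_derive_gamma_integral => //; exact: continuous_cos.
have dz (z u : R) : is_derive u 1 ( *%R z : R -> R) z.
  apply: (is_derive_eq (is_deriveZ z (is_derive_id u (1 : R)))).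
  by rewrite /GRing.scale/= mulr1.
have cz (z : R) : continuous ( *%R z : R -> R).
  by move=> u; apply: cvgM; [exact: cvg_cst|exact: cvg_id].
(* Integration by parts reads I_(a+1) = a I_a + i z I_(a+1); this is the real part and [eS] the
   imaginary part. Below, [alg] solves this linear system, of determinant 1 + z^2, for I_(a+1). *)
have eC (z : R) : K (a + 1) cos z = a * K a cos z - z * K (a + 1) sin z.
  have -> : K (a + 1) cos z = a * K a cos z +
      \int[leb]_(u in `]0%R, +oo[) (gamma_fun (a + 1) u * (- sin (z * u) * z)).
    apply: (@gamma_ibp a (cos \o *%R z) _ `|z| a0).
    - move=> u; apply: cvgM; last exact: cvg_cst.
      by apply: cvgN; apply: continuous_comp; [exact: cz|exact: continuous_sin].
    - by move=> u; exact: cos1.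
    - by move=> u; rewrite normrM normrN ler_piMl.
  congr (_ + _); rewrite -mulNr -RintegralZl//; last first.
    apply: (@integrable_gamma_funM _ _ 1) => //.
    apply: measurableT_comp; last exact: measurable_funM.
    by apply: continuous_measurable_fun; exact: continuous_sin.
  by apply: eq_Rintegral => u _; ring.
have eS (z : R) : K (a + 1) sin z = a * K a sin z + z * K (a + 1) cos z.
  have -> : K (a + 1) sin z = a * K a sin z +
      \int[leb]_(u in `]0%R, +oo[) (gamma_fun (a + 1) u * (cos (z * u) * z)).
    apply: (@gamma_ibp a (sin \o *%R z) _ `|z| a0).
    - move=> u; apply: cvgM; last exact: cvg_cst.
      by apply: continuous_comp; [exact: cz|exact: continuous_cos].
    - by move=> u; exact: sin1.
    - by move=> u; rewrite normrM ler_piMl.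
  congr (_ + _); rewrite -RintegralZl//; last first.
    apply: (@integrable_gamma_funM _ _ 1) => //.
    apply: measurableT_comp; last exact: measurable_funM.
    by apply: continuous_measurable_fun; exact: continuous_cos.
  by apply: eq_Rintegral => u _; ring.
have q0 (z : R) : 0 < 1 + z ^+ 2 by rewrite ltr_pwDl// sqr_ge0.
pose r := (@powR R ^~ (a / 2)) \o (cst 1 + (@id R) ^+ 2).
pose th := a \*: @atan R.
have rE (z : R) : r z = (1 + z ^+ 2) `^ (a / 2) by [].
have dr (z : R) : is_derive z 1 r (a * z * (1 + z ^+ 2)^-1 * r z).
  have dq : is_derive z 1 (cst 1 + (@id R) ^+ 2) (2 * z).
    by apply: is_derive_eq; rewrite add0r /GRing.scale/= mulr1 expr1.
  have := @is_derive1_comp _ (@powR R ^~ (a / 2)) (cst 1 + (@id R) ^+ 2) z _ _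
    (is_derive1_powR (a / 2) (q0 z)) dq.
  move=> /is_derive_eq; apply; rewrite rE powRB; last by rewrite (gt_eqF (q0 z)) implybT.
  by rewrite powRr1 ?ltW//; field; rewrite gt_eqF.
have dth (z : R) : is_derive z 1 th (a * (1 + z ^+ 2)^-1).
  by apply: is_derive_eq.
have dc (z : R) : is_derive z 1 (cos \o th) (- sin (th z) * (a * (1 + z ^+ 2)^-1)).
  exact: is_derive1_comp.
have dsn (z : R) : is_derive z 1 (sin \o th) (cos (th z) * (a * (1 + z ^+ 2)^-1)).
  exact: is_derive1_comp.
have alg (z C S C1 S1 : R) : C1 = a * C - z * S1 -> S1 = a * S + z * C1 ->
    (1 + z ^+ 2) * C1 = a * C - a * z * S /\
    (1 + z ^+ 2) * S1 = a * S + a * z * C.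
  move=> h1 h2; split.
    by rewrite mulrDl mul1r {1}h1 h2; ring.
  by rewrite mulrDl mul1r {1}h2 h1; ring.
have key (z : R) := (alg z _ _ _ _ (eC z) (eS z)).1.
have key' (z : R) := (alg z _ _ _ _ (eC z) (eS z)).2.
(* [A] and [B] are the real and imaginary parts of I_a(z) (1 - i z)^a, where (1 - i z)^a has modulus
   [r z] and argument [- th z]. The differential equation says that this product is constant, so it
   equals its value at 0, the Gamma constant. *)
pose A := r * (K a cos * (cos \o th) + K a sin * (sin \o th)).
pose B := r * (K a sin * (cos \o th) - K a cos * (sin \o th)).
have KC (z : R) : K (a + 1) cos z = (a * K a cos z - a * z * K a sin z) / (1 + z ^+ 2).
  by rewrite -key mulrAC divff ?mul1r// gt_eqF.
have KS (z : R) : K (a + 1) sin z = (a * K a sin z + a * z * K a cos z) / (1 + z ^+ 2).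
  by rewrite -key' mulrAC divff ?mul1r// gt_eqF.
have dA (z : R) : is_derive z 1 A 0.
  apply: is_derive_eq; rewrite /GRing.scale/= !fctE/= KC KS; field.
  by rewrite gt_eqF.
have dB (z : R) : is_derive z 1 B 0.
  apply: is_derive_eq; rewrite /GRing.scale/= !fctE/= KC KS; field.
  by rewrite gt_eqF.
have th0 : th 0 = 0 by rewrite /th/= atan0 /GRing.scale/= mulr0.
have r0 : r 0 = 1 by rewrite rE expr0n/= addr0 powR1.
have K0c : K a cos 0 = gamma_const a.
  by apply: eq_Rintegral => u _; rewrite mul0r cos0 mulr1.
have K0s : K a sin 0 = 0.
  rewrite /K (_ : (fun u => _) = cst 0) ?Rintegral_cst ?mul0r//.
  by apply/funext => u; rewrite mul0r sin0 mulr0.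
have AE : A eta = gamma_const a.
  rewrite (is_derive_0_is_cst eta 0 dA) /A !fctE/= th0 r0 K0c K0s cos0 sin0.
  by rewrite mul0r addr0 mulr1 mul1r.
have BE : B eta = 0.
  rewrite (is_derive_0_is_cst eta 0 dB) /B !fctE/= th0 r0 K0s sin0.
  by rewrite mul0r mulr0 subr0 mulr0.
have r_gt0 : 0 < r eta by rewrite rE powR_gt0.
have rhoE : rho = A eta / r eta by rewrite AE /rho powRN.
have csE := cos2Dsin2 (th eta).
rewrite -[a * atan eta]/(th eta) rhoE.
have {}AE : A eta / r eta =
    K a cos eta * cos (th eta) + K a sin eta * sin (th eta).
  by rewrite /A !fctE/= mulrAC divff ?mul1r// gt_eqF.
(* [B eta = 0] says that rotating the pair of integrals by [- th eta] kills its second component,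
   while the first is [rho]; rotating back gives the claim. *)
move: BE; rewrite /B !fctE/= => /eqP; rewrite mulf_eq0 gt_eqF//= subr_eq0 => /eqP BE.
rewrite AE; split.
- transitivity (K a cos eta * (cos (th eta) ^+ 2 + sin (th eta) ^+ 2)).
    by rewrite csE mulr1.
  transitivity (K a cos eta * cos (th eta) ^+ 2 +
      sin (th eta) * (K a sin eta * cos (th eta))); last by ring.
  by rewrite BE; ring.
- transitivity (K a sin eta * (cos (th eta) ^+ 2 + sin (th eta) ^+ 2)).
    by rewrite csE mulr1.
  transitivity (cos (th eta) * (K a cos eta * sin (th eta)) +
      K a sin eta * sin (th eta) ^+ 2); last by ring.
  by rewrite -BE; ring.
Qed.

End gamma.

(** * The Gamma law as a probability measure *)

Section gamma_probability.
Context (R : realType).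
Notation leb := (@lebesgue_measure R).

Let mI : measurable (`]0, +oo[%classic : set (measurableTypeR R)).
Proof. exact: measurable_itv. Qed.

(** The weight e^((1-k)u) turns e^(-u) into e^(-ku), and the substitution u -> u/k restores the
    Gamma density at the cost k^(-a). The free phase [phi] covers cosine and sine at once and can
    absorb a second variable in iterated integrals. *)
Lemma gamma_probability (a : R) : 0 < a -> exists G : probability R R,
  (forall (k : R) (F : R -> \bar R), 0 < k -> measurable_fun setT F ->
     (forall x, 0 <= F x)%E ->
     (\int[G]_u ((expR ((1 - k) * u))%:E * F u) =
      (k `^ (- a))%:E * \int[G]_u F (u / k)%R)%E) /\
  (forall phi eta : R, \int[G]_u cos (phi + eta * u) =
     (1 + eta ^+ 2) `^ (- (a / 2)) * cos (phi + a * atan eta)).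
Proof.
move=> a0; have G0 := gamma_const_gt0 a0.
pose J : set R := `]0, +oo[%classic.
have JE (u : R) : J u = (0 < u) :> Prop by rewrite /J/= in_itv/= andbT.
pose g (u : R) := gamma_fun a u / gamma_const a * \1_J u.
have mg : measurable_fun setT g.
  apply: measurable_funM; last exact: measurable_indic.
  by apply: measurable_funM => //; exact: measurable_gamma_fun.
have g0 (u : R) : 0 <= g u.
  by rewrite /g mulr_ge0 ?divr_ge0 ?gamma_fun_ge0 ?(ltW G0).
have gJ (f : R -> R) : (fun u => f u * g u) =
    (fun u => (gamma_const a)^-1 * (gamma_fun a u * f u)) \_ J.
  apply/funext => u; rewrite patchE /g indicE; case: ifPn => _.
    by rewrite mulr1; ring.
  by rewrite !mulr0.
have GJ (f : R -> R) (N : R) : measurable_fun setT f -> (forall x, `|f x| <= N) ->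
    \int[leb]_u (f u * g u) =
    (gamma_const a)^-1 * \int[leb]_(u in J) (gamma_fun a u * f u).
  move=> mf fN; rewrite gJ -Rintegral_mkcond RintegralZl//.
  exact: (integrable_gamma_funM _ mf fN).
have g1 : (\int[leb]_u (g u)%:E = 1)%E.
  have : \int[leb]_u (1 * g u) = 1.
    rewrite (@GJ (cst 1) 1)//; last by move=> x; rewrite normr1.
    rewrite (_ : (fun u => _) = gamma_fun a) ?mulVf ?gt_eqF//.
    by apply/funext => u; rewrite mulr1.
  rewrite /Rintegral; under eq_integral do rewrite mul1r.
  (* [fine] sends infinite values to 0, so a real integral equal to 1 excludes them. *)
  by case: (\int[leb]_u (g u)%:E)%E => /= [r ->//|/esym/eqP|/esym/eqP]; rewrite oner_eq0.
have [G GE] := lebesgue_density_probability mg g0 g1.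
exists G; split=> [k F k0 mF F0|phi eta].
- rewrite (ge0_integral_lebesgue_density mg g0 GE)//; last 2 first.
  + apply: emeasurable_funM => //; apply/measurable_EFinP.
    by apply: measurableT_comp => //; exact: measurable_funM.
  + by move=> x; rewrite mule_ge0// lee_fin expR_ge0.
  have mFk : measurable_fun setT (fun u : R => F (u / k)).
    by apply: measurableT_comp => //; exact: measurable_funM.
  rewrite (ge0_integral_lebesgue_density mg g0 GE)//.
  rewrite [in RHS](ge0_integral_lebesgue_scale k0); last 2 first.
  + by apply: emeasurable_funM => //; exact/measurable_EFinP.
  + by move=> x; rewrite mule_ge0// lee_fin.
  rewrite muleA -ge0_integralZl//; last 3 first.
  + apply: emeasurable_funM => //.
      rewrite (_ : (fun x => F (k * x / k)) = F)//; apply/funext => x.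
      by congr F; field; rewrite gt_eqF.
    by apply/measurable_EFinP; apply: (measurableT_comp mg); exact: measurable_funM.
  + by move=> x _; rewrite mule_ge0// lee_fin.
  + by rewrite lee_fin mulr_ge0 ?powR_ge0// ltW.
  apply: eq_integral => x _.
  have -> : (k * x / k = x)%R by field; rewrite gt_eqF.
  rewrite [((expR _)%:E * F x)%E]muleC -muleA [RHS]muleCA; congr (_ * _)%E.
  rewrite -!EFinM; congr EFin; rewrite /g !indicE.
  have [x0|x0] := ltP 0 x; last first.
    rewrite !memNset ?mulr0//.
      by rewrite JE; apply/negP; rewrite -leNgt pmulr_rle0.
    by rewrite JE; apply/negP; rewrite -leNgt.
  rewrite !mem_set ?JE ?mulr_gt0// /gamma_fun powRM ?ltW//.
  rewrite powRN (@powRB _ k a 1) ?(gt_eqF k0) ?implybT// powRr1 ?ltW//.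
  have -> : expR ((1 - k) * x) = expR (- (k * x)) / expR (- x).
    by rewrite -expRN -expRD; congr expR; ring.
  field; rewrite !gt_eqF ?powR_gt0 ?expR_gt0//.
- have mc (s : R -> R) : continuous s -> measurable_fun setT (fun u : R => s (eta * u)).
    move=> cs; apply: measurableT_comp; last exact: measurable_funM.
    exact: continuous_measurable_fun.
  have [C S] := gamma_charfun eta a0.
  have mcos : measurable_fun setT (fun u : R => cos (phi + eta * u)).
    apply: measurableT_comp => //; first exact: continuous_measurable_fun (@continuous_cos R).
    by apply: measurable_funD => //; exact: measurable_funM.
  rewrite {1}/Rintegral (integral_lebesgue_density mg g0 GE)//; last first.
    exact/measurable_EFinP.
  rewrite -[LHS]/(\int[leb]_u (cos (phi + eta * u) * g u)).
  have cos1 (x : R) : `|cos x| <= 1 by rewrite ler_norml cos_geN1 cos_le1.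
  have sin1 (x : R) : `|sin x| <= 1 by rewrite ler_norml sin_geN1 sin_le1.
  rewrite (@GJ _ 1)//.
  have iC : leb.-integrable J (EFin \o (fun u => gamma_fun a u * cos (eta * u))).
    by apply: (@integrable_gamma_funM _ _ _ 1) => //; apply: mc; exact: continuous_cos.
  have iS : leb.-integrable J (EFin \o (fun u => gamma_fun a u * sin (eta * u))).
    by apply: (@integrable_gamma_funM _ _ _ 1) => //; apply: mc; exact: continuous_sin.
  have iZ (f : R -> R) c : leb.-integrable J (EFin \o f) ->
      leb.-integrable J (EFin \o (fun u => c * f u)).
    move=> i; have := integrableZl mI c i.
    by apply: eq_integrable => // x _; rewrite /= EFinM.
  transitivity ((gamma_const a)^-1 * \int[leb]_(u in J)
      (cos phi * (gamma_fun a u * cos (eta * u)) -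
       sin phi * (gamma_fun a u * sin (eta * u)))).
    by congr (_ * _); apply: eq_Rintegral => u _; rewrite cosD; ring.
  rewrite RintegralB//; [|exact: iZ|exact: iZ].
  rewrite !RintegralZl// C S cosD; field.
  by rewrite gt_eqF.
Qed.

End gamma_probability.

(** * Uniqueness of characteristic functions *)

Section charfun_uniqueness.
Context (R : realType).
Notation leb := (@lebesgue_measure R).
Implicit Types (V W : probability R R).

Let mI : measurable (`]0, +oo[%classic : set (measurableTypeR R)).
Proof. exact: measurable_itv. Qed.

Let expRMN_cont (eps : R) : continuous (fun x : R => expR (- (eps * x))).
Proof.
move=> x; apply: continuous_comp; last exact: continuous_expR.
by apply: cvgN; apply: cvgM; [exact: cvg_cst|exact: cvg_id].
Qed.

Let is_derive_mull (c x : R) : is_derive x 1 ( *%R c : R -> R) c.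
Proof.
apply: (is_derive_eq (is_deriveZ c (is_derive_id x (1 : R)))).
by rewrite /GRing.scale/= mulr1.
Qed.

Let is_derive_expRN (eps x : R) :
  is_derive x 1 (fun x : R => expR (- (eps * x))) (- eps * expR (- (eps * x))).
Proof.
have -> : (fun x : R => expR (- (eps * x))) = expR \o *%R (- eps).
  by apply/funext => y /=; rewrite mulNr.
apply: (is_derive_eq (is_derive1_comp (is_derive_expR _) (is_derive_mull (- eps) x))).
by rewrite mulNr mulrC.
Qed.

Lemma integrable_expRMN (eps : R) : 0 < eps ->
  leb.-integrable `]0, +oo[ (fun x : R => (expR (- (eps * x)))%:E).
Proof.
move=> e0.
apply: (@ge0_integrable_itv0y_FTC _ _ (fun x => - eps^-1 * expR (- (eps * x))) eps^-1).
- by move=> x _; exact: expR_ge0.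
- move=> x x0; apply: (is_derive_eq (is_deriveZ (- eps^-1) (is_derive_expRN eps x))).
  by rewrite /GRing.scale/=; field; rewrite gt_eqF.
- by move=> x _; exact: expRMN_cont.
- move=> x x0; rewrite normrM normrN !ger0_norm ?invr_ge0 ?expR_ge0 ?(ltW e0)//.
  rewrite ler_piMr ?invr_ge0 ?(ltW e0)// -[leRHS]expR0 ler_expR oppr_le0.
  by rewrite ltW// mulr_gt0.
Qed.

(** The Laplace transform of the cosine, read backwards: the Cauchy kernel is a superposition of
    cosines with weight e^(- eps x). *)
Lemma integral_poisson_kernel (eps z : R) : 0 < eps ->
  (\int[leb]_(x in `]0%R, +oo[) (expR (- (eps * x)) * cos (z * x))%:E =
   (eps / (eps ^+ 2 + z ^+ 2))%:E)%E.
Proof.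
move=> e0.
have D0 : 0 < eps ^+ 2 + z ^+ 2 by rewrite ltr_wpDr ?sqr_ge0// exprn_gt0.
pose E (x : R) := expR (- (eps * x)).
(* The antiderivative [E * N] is the real part of e^((- eps + i z) x) / (- eps + i z). *)
pose N (x : R) := (z * sin (z * x) - eps * cos (z * x)) / (eps ^+ 2 + z ^+ 2).
pose F := E * N.
have cz : continuous ( *%R z : R -> R).
  by move=> x; apply: cvgM; [exact: cvg_cst|exact: cvg_id].
have ccz : continuous (fun x : R => cos (z * x)).
  by move=> x; apply: continuous_comp; [exact: cz|exact: continuous_cos].
have csz : continuous (fun x : R => sin (z * x)).
  by move=> x; apply: continuous_comp; [exact: cz|exact: continuous_sin].
have cF : continuous F.
  move=> x; apply: cvgM; first exact: expRMN_cont.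
  apply: cvgM; last exact: cvg_cst.
  by apply: cvgB; (apply: cvgM; first exact: cvg_cst); [exact: csz|exact: ccz].
have F0 : F 0 = - (eps / (eps ^+ 2 + z ^+ 2)).
  rewrite /F /E /N !fctE/= !mulr0 oppr0 expR0 sin0 cos0; field.
  by rewrite gt_eqF.
have cos1 (x : R) : `|cos x| <= 1 by rewrite ler_norml cos_geN1 cos_le1.
have sin1 (x : R) : `|sin x| <= 1 by rewrite ler_norml sin_geN1 sin_le1.
rewrite (_ : eps / _ = 0 - F 0); last by rewrite F0 opprK add0r.
apply: (@integral_itv0y_FTC _ _ F).
- apply: (@le_integrable _ _ _ leb _ _ _ (fun x : R => (E x)%:E)) => //.
  + apply/measurable_EFinP/measurable_funTS; apply: measurable_funM.
      by apply: continuous_measurable_fun; exact: expRMN_cont.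
    exact: continuous_measurable_fun.
  + move=> x _; rewrite /= lee_fin normrM ler_piMr//.
  + exact: integrable_expRMN.
- move=> x x0.
  have dE := is_derive_expRN eps x.
  have dc := is_derive1_comp (is_derive_cos (z * x)) (is_derive_mull z x).
  have ds := is_derive1_comp (is_derive_sin (z * x)) (is_derive_mull z x).
  have dN : is_derive x 1 N ((eps ^+ 2 + z ^+ 2)^-1 *
      (z * (cos (z * x) * z) - eps * (- sin (z * x) * z))).
    have -> : N = (eps ^+ 2 + z ^+ 2)^-1 \*: (z \*: (sin \o *%R z) - eps \*: (cos \o *%R z)).
      by apply/funext => y; rewrite /N !fctE/= /GRing.scale/= mulrC.
    exact: is_deriveZ (is_deriveB (is_deriveZ z ds) (is_deriveZ eps dc)).
  apply: (is_derive_eq (is_deriveM dE dN)).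
  rewrite /GRing.scale/= /N /E; field; rewrite gt_eqF//.
- move=> x _; apply: cvgM; first exact: expRMN_cont.
  exact: ccz.
- apply: (@continuous_cvg _ _ _ _ _ (fun n => n.+1%:R^-1 : R) F).
    exact: cF.
  exact: cvg_harmonic.
- apply: norm_cvg0.
  (* Since e^(eps x) >= eps x, the exponential is at most 1 / (eps x), and the numerator of [N] is
     at most |z| + eps. *)
  pose K := (`|z| + eps) / (eps ^+ 2 + z ^+ 2) / eps.
  apply: (@squeeze_cvgr _ _ _ _ (cst 0) (fun n => K * n.+1%:R^-1)); last 2 first.
  + exact: cvg_cst.
  + by rewrite -[X in _ --> X](mulr0 K); apply: cvgM; [exact: cvg_cst|exact: cvg_harmonic].
  apply: nearW => n; rewrite normr_ge0/= /F !fctE normrM.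
  have -> : K * n.+1%:R^-1 = (eps * n.+1%:R)^-1 * ((`|z| + eps) / (eps ^+ 2 + z ^+ 2)).
    by rewrite /K; field; rewrite !gt_eqF.
  have en0 : 0 < eps * n.+1%:R by rewrite mulr_gt0.
  rewrite ler_pM//.
    rewrite /E ger0_norm ?expR_ge0// expRN lef_pV2 ?posrE ?expR_gt0//.
    by rewrite (le_trans _ (expR_ge1Dx _))// lerDr.
  rewrite /N normrM (@ger0_norm _ (_^-1)) ?invr_ge0 ?(ltW D0)// ler_wpM2r ?invr_ge0 ?(ltW D0)//.
  rewrite (le_trans (ler_normB _ _))// !normrM (gtr0_norm e0) lerD//.
    by rewrite ler_piMr.
  by rewrite ler_piMr// ltW.
Qed.

Lemma integral_poisson_itv (eps x p q : R) : 0 < eps -> p < q ->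
  (\int[leb]_(y in `[p, q]) (eps / (eps ^+ 2 + (y - x) ^+ 2))%:E =
   (atan ((q - x) / eps) - atan ((p - x) / eps))%:E)%E.
Proof.
move=> e0 pq.
have D0 (y : R) : 0 < eps ^+ 2 + (y - x) ^+ 2.
  by rewrite ltr_wpDr ?sqr_ge0// exprn_gt0.
pose A (y : R) := atan ((y - x) / eps).
have dA (y : R) : is_derive y 1 A (eps / (eps ^+ 2 + (y - x) ^+ 2)).
  have -> : A = atan \o *%R eps^-1 \o (fun y => y - x).
    by apply/funext => z /=; rewrite /A mulrC.
  have ds : is_derive y 1 (fun y : R => y - x) 1.
    apply: (is_derive_eq (is_deriveB (is_derive_id y (1 : R)) (is_derive_cst x y (1 : R)))).
    by rewrite subr0.
  have dm := @is_derive1_comp _ ( *%R eps^-1) (fun y => y - x) y _ _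
    (is_derive_mull eps^-1 (y - x)) ds.
  have := @is_derive1_comp _ atan _ y _ _ (is_derive1_atan (eps^-1 * (y - x))) dm.
  move=> d; apply: (is_derive_eq d); field.
  by rewrite !gt_eqF// ?D0// [X in 0 < X](_ : _ = eps ^+ 2 + (y - x) ^+ 2) ?D0//; ring.
have cA : continuous A.
  move=> y; apply: differentiable_continuous; apply/derivable1_diffP.
  by have [] := dA y.
rewrite (@continuous_FTC2 _ _ A)//.
- apply: continuous_subspaceT => y; apply: cvgM; first exact: cvg_cst.
  apply: cvgV; first by rewrite gt_eqF.
  apply: cvgD; first exact: cvg_cst.
  apply: (@continuous_comp _ _ _ (fun y => y - x) (fun z => z ^+ 2)).
    by apply: cvgB; [exact: cvg_id|exact: cvg_cst].
  exact: exprn_continuous.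
- split.
  + by move=> y _; have [] := dA y.
  + by apply: cvg_at_right_filter; exact: cA.
  + by apply: cvg_at_left_filter; exact: cA.
- by move=> y _; rewrite derive1E; have [_] := dA y.
Qed.

(** The left side is pi times the density at y of [V] convolved with a Cauchy law of scale eps; the
    right side sees [V] only through its characteristic function. Fubini applies because e^(- eps
    xi) dominates the oscillating integrand and [V] has mass 1. *)
Lemma integral_poisson_charfun V (eps y : R) : 0 < eps ->
  (\int[V]_x (eps / (eps ^+ 2 + (y - x) ^+ 2))%:E =
   \int[leb]_(xi in `]0%R, +oo[) (expR (- (eps * xi)) *
     (cos (y * xi) * Rintegral V setT (fun x => cos (xi * x)) +
      sin (y * xi) * Rintegral V setT (fun x => sin (xi * x))))%:E)%E.
Proof.
move=> e0; pose J : set R := `]0, +oo[%classic.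
have cos1 (x : R) : `|cos x| <= 1 by rewrite ler_norml cos_geN1 cos_le1.
have sin1 (x : R) : `|sin x| <= 1 by rewrite ler_norml sin_geN1 sin_le1.
pose e (xi : R) := expR (- (eps * xi)) * \1_J xi.
have e_ge0 xi : 0 <= e xi by rewrite mulr_ge0 ?expR_ge0// indicE.
have me : measurable_fun setT e.
  apply: measurable_funM; last exact: measurable_indic.
  by apply: continuous_measurable_fun; exact: expRMN_cont.
pose h (z : R * measurableTypeR R) := (e z.2 * cos ((y - z.1) * z.2))%:E.
have mh : measurable_fun setT h.
  apply/measurable_EFinP; apply: measurable_funM.
    exact: measurableT_comp.
  apply: measurableT_comp.
    by apply: continuous_measurable_fun; exact: continuous_cos.
  by apply: measurable_funM => //; apply: measurable_funB.
have eJ (f : R -> R) : (fun xi => (e xi * f xi)%:E) =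
    (fun xi => (expR (- (eps * xi)) * f xi)%:E) \_ J.
  apply/funext => xi; rewrite patchE /e indicE; case: ifPn => _.
    by rewrite mulr1.
  by rewrite mulr0 mul0r.
have ie : leb.-integrable setT (fun xi => (e xi)%:E).
  have -> : (fun xi => (e xi)%:E) = (fun xi : R => (expR (- (eps * xi)))%:E) \_ J.
    apply/funext => xi; rewrite patchE /e indicE; case: ifPn => _.
      by rewrite mulr1.
    by rewrite mulr0.
  by apply: (integrable_mkcond _ mI).1; exact: integrable_expRMN.
have ih : (V \x leb)%E.-integrable setT h.
  have me2 : measurable_fun setT (fun z : R * measurableTypeR R => (e z.2)%:E).
    by apply/measurable_EFinP; apply: (measurableT_comp me); exact: measurable_snd.
  apply: (@le_integrable _ _ _ _ _ _ _ (fun z : R * measurableTypeR R => (e z.2)%:E)) => //.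
    move=> z _; rewrite /h/= lee_fin normrM.
    by rewrite ler_piMr.
  apply/integrableP; split => //.
  under eq_integral do rewrite gee0_abs ?lee_fin//.
  rewrite fubini_tonelli1//; last by move=> z; rewrite lee_fin.
  rewrite (_ : fubini_F _ _ = cst (\int[leb]_xi (e xi)%:E)%E)// integral_cst//.
  rewrite [X in (_ * X)%E](_ : _ = 1%E) ?mule1; last exact: probability_setT.
  exact: integrable_lty ie.
transitivity (\int[V]_x \int[leb]_xi h (x, xi))%E.
  apply: eq_integral => x _; rewrite /h/= (eJ (fun xi => cos ((y - x) * xi))).
  by rewrite -integral_mkcond integral_poisson_kernel.
rewrite (Fubini ih) [RHS]integral_mkcond.
rewrite -(eJ (fun xi => cos (y * xi) * Rintegral V setT (fun x => cos (xi * x)) +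
      sin (y * xi) * Rintegral V setT (fun x => sin (xi * x)))).
apply: eq_integral => xi _; rewrite /h/=.
have bint (s : R -> R) : continuous s -> (forall x, `|s x| <= 1) ->
    V.-integrable setT (EFin \o (fun x => s (xi * x))).
  move=> cs s1; apply: measurable_bounded_integrable => //.
  - by rewrite -ge0_fin_numE// fin_num_measure.
  - apply: measurableT_comp; last exact: measurable_funM.
    exact: continuous_measurable_fun.
  - by exists 1; split => // M M1 x _ /=; rewrite (le_trans (s1 _))// ltW.
have iZ (f : R -> R) c : V.-integrable setT (EFin \o f) ->
    V.-integrable setT (EFin \o (fun u => c * f u)).
  move=> i; have := integrableZl measurableT c i.
  by apply: eq_integrable => // x _; rewrite /= EFinM.
have ic := bint _ (@continuous_cos R) cos1.
have is_ := bint _ (@continuous_sin R) sin1.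
transitivity (\int[V]_x (e xi * (cos (y * xi) * cos (xi * x) +
    sin (y * xi) * sin (xi * x)))%:E)%E.
  apply: eq_integral => x _.
  by rewrite mulrBl cosB [(x * xi)%R]mulrC.
have isum : V.-integrable setT (EFin \o (fun x => cos (y * xi) * cos (xi * x) +
    sin (y * xi) * sin (xi * x))).
  have := integrableD measurableT (iZ _ (cos (y * xi)) ic) (iZ _ (sin (y * xi)) is_).
  by apply: eq_integrable.
have i := iZ _ (e xi) isum.
rewrite -(fineK (integrable_fin_num measurableT i)); congr EFin.
rewrite -[LHS]/(Rintegral V setT (fun x => e xi * (cos (y * xi) * cos (xi * x) +
    sin (y * xi) * sin (xi * x)))).
rewrite RintegralZl//; congr (_ * _).
by rewrite RintegralD//; [rewrite !RintegralZl|exact: iZ|exact: iZ].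
Qed.

(** The extra term n + 1, of lower order than (n + 1)^2, decides the case c = 0: without it the
    limit there would be 0, and smoothing would see only half of an atom at an end point. *)
Let cvg_atan_seq (c : R) :
  atan (c * n.+1%:R ^+ 2 + n.+1%:R) @[n --> \oo] -->
    (if 0 <= c then pi / 2 else - (pi / 2)).
Proof.
have cvg_n : (n.+1%:R : R) @[n --> \oo] --> +oo.
  by apply/cvgryPge => A; near=> n; rewrite (le_trans (ltW (truncnS_gt A)))// ler_nat ltnS;
    near: n; exact: nbhs_infty_ge.
case: ifPn => [c0|]; last rewrite -ltNge => c0.
  apply: (@cvg_comp _ _ _ (fun n => c * n.+1%:R ^+ 2 + n.+1%:R) (@atan R) _ (pinfty_nbhs R)).
    apply: (@ger_cvgy _ _ _ _ (fun n => n.+1%:R)) => //.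
    by apply: nearW => n; rewrite lerDr mulr_ge0.
  exact: cvgy_atan.
rewrite (_ : (fun n => _) = (fun n => - atan (- c * n.+1%:R ^+ 2 - n.+1%:R))); last first.
  by apply/funext => n; rewrite -atanN; congr atan; ring.
apply: cvgN.
apply: (@cvg_comp _ _ _ (fun n => - c * n.+1%:R ^+ 2 - n.+1%:R) (@atan R) _ (pinfty_nbhs R)).
  apply: (@ger_cvgy _ _ _ _ (fun n => n.+1%:R)) => //.
  near=> n.
  have : 2 / - c <= n.+1%:R by near: n; move/cvgryPge: cvg_n; exact.
  rewrite ler_pdivrMr ?oppr_gt0// => h.
  have n0 : 0 < n.+1%:R :> R by [].
  rewrite lerBrDr -mulr2n -[leLHS]mulr_natl expr2 mulrA ler_pM2r//.
  by rewrite mulrC.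
exact: cvgy_atan.
Unshelve. all: end_near. Qed.

(** The Cauchy-smoothed densities coincide; integrating them over shrinking perturbations of [p, q]
    recovers the masses of the intervals ]p, q], atoms at the end points included, and these
    intervals determine a probability. *)
Theorem charfun_inj V W : (forall xi, charfun V xi = charfun W xi) ->
  forall A, measurable A -> V A = W A.
Proof.
move=> VW.
have hc xi : Rintegral V setT (fun x => cos (xi * x)) =
    Rintegral W setT (fun x => cos (xi * x)) by have [] := VW xi.
have hs xi : Rintegral V setT (fun x => sin (xi * x)) =
    Rintegral W setT (fun x => sin (xi * x)) by have [] := VW xi.
have key1 (eps y : R) : 0 < eps ->
    (\int[V]_x (eps / (eps ^+ 2 + (y - x) ^+ 2))%:E =
     \int[W]_x (eps / (eps ^+ 2 + (y - x) ^+ 2))%:E)%E.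
  move=> e0; rewrite !integral_poisson_charfun//.
  by apply: eq_integral => xi _; rewrite hc hs.
(* Tonelli: the mass that the smoothed law gives to [p, q] is an expectation of a bounded arctangent
   difference, ready for a limit in eps. *)
have T (U : probability R R) (eps p q : R) : 0 < eps -> p < q ->
    (\int[U]_x (atan ((q - x) / eps) - atan ((p - x) / eps))%:E =
     \int[leb]_(y in `[p, q]) \int[U]_x (eps / (eps ^+ 2 + (y - x) ^+ 2))%:E)%E.
  move=> e0 pq.
  have D0 (y : R) : 0 < eps ^+ 2 + y ^+ 2.
    by rewrite ltr_wpDr ?sqr_ge0// exprn_gt0.
  pose k (z : R * measurableTypeR R) :=
    (eps / (eps ^+ 2 + (z.2 - z.1) ^+ 2) * \1_(`[p, q]%classic : set R) z.2)%:E.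
  have k0 z : (0 <= k z)%E.
    by rewrite lee_fin mulr_ge0 ?divr_ge0 ?(ltW e0) ?(ltW (D0 _))// indicE.
  have mk : measurable_fun setT k.
    apply/measurable_EFinP; apply: measurable_funM; last first.
      by apply: measurableT_comp => //; exact: measurable_indic.
    apply: measurable_funM => //.
    apply: (@measurableT_comp _ _ _ _ _ _ (fun y : R => (eps ^+ 2 + y ^+ 2)^-1)
      _ (fun z : R * measurableTypeR R => z.2 - z.1 : R)).
      apply: continuous_measurable_fun => y.
      apply: cvgV; first by rewrite gt_eqF.
      by apply: cvgD; [exact: cvg_cst|exact: exprn_continuous].
    by apply: measurable_funB.
  rewrite [RHS]integral_mkcond.
  transitivity (\int[U]_x \int[leb]_y k (x, y))%E.
    apply: eq_integral => x _; rewrite -integral_poisson_itv// integral_mkcond.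
    apply: eq_integral => y _; rewrite /k patchE indicE/=; case: ifPn => _.
      by rewrite mulr1.
    by rewrite mulr0.
  rewrite (fubini_tonelli k)//.
  apply: eq_integral => y _; rewrite patchE; case: ifPn => yp.
    by apply: eq_integral => x _; rewrite /k/= indicE yp mulr1.
  by apply: integral0_eq => x _; rewrite /k/= indicE (negbTE yp) mulr0.
have key2 (eps p q : R) : 0 < eps -> p < q ->
    (\int[V]_x (atan ((q - x) / eps) - atan ((p - x) / eps))%:E =
     \int[W]_x (atan ((q - x) / eps) - atan ((p - x) / eps))%:E)%E.
  by move=> e0 pq; rewrite !T//; apply: eq_integral => y _; exact: key1.
(* Scale eps = (n + 1)^-2 with both end points moved right by (n + 1)^-1. The shift is large
   compared with eps, so the limit is pi times the indicator of ]p, q] at every point. *)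
pose D p q n (x : R) := atan ((q - x) * n.+1%:R ^+ 2 + n.+1%:R) -
                  atan ((p - x) * n.+1%:R ^+ 2 + n.+1%:R).
have mD (p q : R) n : measurable_fun setT (D p q n).
  have mat (c : R) : measurable_fun setT
      (fun x : R => atan ((c - x) * n.+1%:R ^+ 2 + n.+1%:R)).
    apply: measurableT_comp.
      by apply: continuous_measurable_fun; exact: continuous_atan.
    apply: measurable_funD => //; apply: measurable_funM => //.
    exact: measurable_funB.
  exact: measurable_funB.
have limD (U : probability R R) (p q : R) : p < q ->
    (\int[U]_x (D p q n x)%:E)%E @[n --> \oo] --> (pi%:E * U `]p, q]%classic)%E.
  move=> pq.
  have -> : U `]p, q]%classic = (\int[U]_x (\1_(`]p, q]%classic : set R) x)%:E)%E.
    by rewrite integral_indic// setIT.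
  rewrite -ge0_integralZl//; last 2 first.
    by apply/measurable_EFinP; exact: measurable_indic.
    by rewrite lee_fin pi_ge0.
  apply: (@dominated_cvg _ _ _ U setT _ _ _ (cst pi%:E)) => //.
  - by move=> n; exact/measurable_EFinP.
  - move=> x _; rewrite -EFinM; apply: cvg_EFin; first exact: nearW.
    have -> : pi * \1_(`]p, q]%classic : set R) x =
        (if 0 <= q - x then pi / 2 else - (pi / 2)) -
        (if 0 <= p - x then pi / 2 else - (pi / 2)) :> R.
      rewrite indicE !subr_ge0; have [xq|qx] := leP x q; have [xp|px] := leP x p.
      + by rewrite memNset ?mulr0 ?subrr//= in_itv/= ltNge xp.
      + by rewrite mem_set ?mulr1 ?opprK -?splitr//= in_itv/= px.
      + by have := lt_le_trans (lt_le_trans qx xp) (ltW pq); rewrite ltxx.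
      + by rewrite memNset ?mulr0 ?subrr//= in_itv/= leNgt qx andbF.
    by apply: cvgB; exact: cvg_atan_seq.
  - exact: finite_measure_integrable_cst.
  - move=> n x _; rewrite /= lee_fin /D (le_trans (ler_normB _ _))//.
    have at1 (z : R) : `|atan z| <= pi / 2.
      by rewrite ler_norml (ltW (atan_gtNpi2 z)) (ltW (atan_ltpi2 z)).
    by rewrite (le_trans (lerD (at1 _) (at1 _)))// -splitr.
have key3 (p q : R) : p < q -> V `]p, q]%classic = W `]p, q]%classic.
  move=> pq; have cV := limD V p q pq; have cW := limD W p q pq.
  have DE (U : probability R R) n : (\int[U]_x (D p q n x)%:E)%E =
      (\int[U]_x (atan ((q + n.+1%:R^-1 - x) / (n.+1%:R ^+ 2)^-1) -
                  atan ((p + n.+1%:R^-1 - x) / (n.+1%:R ^+ 2)^-1))%:E)%E.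
    apply: eq_integral => x _; congr EFin; rewrite /D.
    by congr (atan _ - atan _); field.
  have EE : (fun n => \int[V]_x (D p q n x)%:E)%E = (fun n => \int[W]_x (D p q n x)%:E)%E.
    by apply/funext => n; rewrite !DE key2// ?ltrD2r// invr_gt0 exprn_gt0.
  rewrite EE in cV.
  have /eqP : (pi%:E * V `]p, q]%classic = pi%:E * W `]p, q]%classic)%E.
    by apply: (cvg_unique _ cV cW).
  rewrite -(fineK (fin_num_measure V _ (measurable_itv _))).
  rewrite -(fineK (fin_num_measure W _ (measurable_itv _))).
  rewrite -!EFinM eqe => /eqP /(mulfI (lt0r_neq0 (pi_gt0 R))) ->//.
apply: (measure_unique (@ocitv R) (fun n => `](- n%:R), n%:R]%classic)) => //.
- exact: ocitvI.
- by move=> n; exact: is_ocitv.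
- apply/seteqP; split => // x _; exists (Num.truncn `|x|).+1 => //=.
  rewrite in_itv/= ltrNl; have := truncnS_gt `|x|.
  move=> h; rewrite (le_lt_trans _ h) ?(ltW (le_lt_trans _ h))//.
    exact: ler_norm.
  by rewrite -normrN ler_norm.
- move=> A [[p q] _ <-]/=; have [pq|qp] := ltP p q; first exact: key3.
  by rewrite set_itv_ge ?measure0// bnd_simp -leNgt.
- by move=> n; rewrite -ge0_fin_numE// fin_num_measure.
Qed.

End charfun_uniqueness.

(** * Esscher transforms of Variance-Gamma laws *)

Section vg_law.
Context (R : realType).
Implicit Types (m d s a c x xi h : R).

Lemma sin_atan x : sin (atan x) = x / Num.sqrt (1 + x ^+ 2).
Proof.
have c0 : cos (atan x) != 0.
  by rewrite gt_eqF// cos_gt0_pihalf// atan_gtNpi2 atan_ltpi2.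
by rewrite -cos_atan -{2}(atanK x) /tan divfK.
Qed.

(** The base of the power factors as (1 - i c1 xi)(1 + i c2 xi). Each factor has positive real part,
    so the arguments add up without leaving the principal range, and the principal power splits. *)
Lemma vg_charfunE m d s a c c1 c2 xi : 0 < c1 -> 0 < c2 ->
  c1 - c2 = d * c -> c1 * c2 = 2^-1 * s ^+ 2 * c ->
  let rho := (1 + (c1 * xi) ^+ 2) `^ (- (a / 2)) *
             (1 + (c2 * xi) ^+ 2) `^ (- (a / 2)) in
  let phi := m * xi + a * (atan (c1 * xi) - atan (c2 * xi)) in
  vg_charfun m d s a c xi = (rho * cos phi +i* (rho * sin phi))%C.
Proof.
move=> c10 c20 h1 h2 rho phi.
pose x1 := c1 * xi; pose x2 := c2 * xi.
have q0 x : 0 < 1 + x ^+ 2 by rewrite ltr_pwDl// sqr_ge0.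
pose n1 := Num.sqrt (1 + x1 ^+ 2); pose n2 := Num.sqrt (1 + x2 ^+ 2).
have n10 : 0 < n1 by rewrite sqrtr_gt0.
have n20 : 0 < n2 by rewrite sqrtr_gt0.
have n1E : n1 ^+ 2 = 1 + x1 ^+ 2 by rewrite sqr_sqrtr ?ltW.
have n2E : n2 ^+ 2 = 1 + x2 ^+ 2 by rewrite sqr_sqrtr ?ltW.
pose th := atan x1 - atan x2.
have cth : cos th = (1 + x1 * x2) / (n1 * n2).
  rewrite /th cosB !cos_atan !sin_atan -/n1 -/n2; field.
  by rewrite !gt_eqF.
have sth : sin th = (x1 - x2) / (n1 * n2).
  rewrite /th sinB !cos_atan !sin_atan -/n1 -/n2; field.
  by rewrite !gt_eqF.
rewrite /vg_charfun /Cpow.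
set z := (X in Normc.normc X).
have zE : z = ((1 + x1 * x2) +i* (x2 - x1))%C.
  transitivity ((1 - 0 + 2^-1 * s ^+ 2 * c * xi ^+ 2) +i* (0 - d * c * xi + 0))%C.
    by [].
  by congr Complex; rewrite -?h2 -?h1 /x1 /x2; ring.
have nz : Normc.normc z = n1 * n2.
  rewrite zE /= -[RHS]ger0_norm ?mulr_ge0 ?ltW// -sqrtr_sqr; congr Num.sqrt.
  by rewrite exprMn n1E n2E; ring.
(* The cosine fixes the argument up to sign, and the sign of the imaginary part x2 - x1 settles it;
   [thlt] is what rules out a jump by 2 pi. *)
have az : Carg z = - th.
  rewrite /Carg nz zE/= -cth subr_ge0.
  have thlt : `|th| <= pi.
    have := atan_gtNpi2 x1; have := atan_gtNpi2 x2.
    have := atan_ltpi2 x1; have := atan_ltpi2 x2 => u1 u2 u3 u4.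
    rewrite ler_norml /th; apply/andP; split; lra.
  move: thlt; rewrite ler_norml => /andP[thN thp].
  case: ifPn => [x12|].
    have th0 : th <= 0 by rewrite subr_le0 le_atan.
    by rewrite cosKN// thN.
  rewrite -ltNge => x12.
  have th0 : 0 <= th by rewrite subr_ge0 le_atan// ltW.
  by rewrite cosK// in_itv/= th0.
have powE : Normc.normc z `^ (- a) = rho.
  have sqE x : (Num.sqrt (1 + x ^+ 2)) `^ (- a) = (1 + x ^+ 2) `^ (- (a / 2)).
    by rewrite -powR12_sqrt ?ltW// -powRrM; congr powR; field.
  by rewrite nz powRM ?ltW// !sqE.
rewrite az powE /expi.
have -> : - a * - th = a * th by ring.
have mulcE (u v u' v' : R) :
  (u +i* v)%C * (u' +i* v')%C = ((u * u' - v * v') +i* (u * v' + v * u'))%C by [].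
rewrite -[(rho%:C)%C]/(rho +i* 0)%C !mulcE /phi -/x1 -/x2 -/th cosD sinD.
by congr Complex; ring.
Qed.

(** One family for all parameters, because tilting moves inside it: e^(h x) splits over the two
    independent variables, with rescaling factors k = 1 - h c1 and k = 1 + h c2 in the Gamma tilting
    identity. *)
Lemma gamma_difference_law a : 0 < a -> exists W : R -> R -> R -> probability R R,
  (forall m c1 c2 xi,
    let rho := (1 + (c1 * xi) ^+ 2) `^ (- (a / 2)) *
               (1 + (c2 * xi) ^+ 2) `^ (- (a / 2)) in
    let phi := m * xi + a * (atan (c1 * xi) - atan (c2 * xi)) in
    charfun (W m c1 c2) xi = (rho * cos phi +i* (rho * sin phi))%C) /\
  (forall m c1 c2 h (F : R -> \bar R), 0 < 1 - h * c1 -> 0 < 1 + h * c2 ->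
    measurable_fun setT F -> (forall x, 0 <= F x)%E ->
    (\int[W m c1 c2]_x ((expR (h * x))%:E * F x) =
     (expR (m * h) * ((1 - h * c1) * (1 + h * c2)) `^ (- a))%:E *
     \int[W m (c1 / (1 - h * c1))%R (c2 / (1 + h * c2))%R]_x F x)%E).
Proof.
move=> a0; have [G [Gscale Gcos]] := gamma_probability a0.
pose X m c1 c2 (z : R * R) : R := m + c1 * z.1 - c2 * z.2.
have mX m c1 c2 : measurable_fun setT (X m c1 c2).
  apply: measurable_funB; last exact: measurable_funM.
  by apply: measurable_funD => //; exact: measurable_funM.
pose mixX m c1 c2 := isMeasurableFun.Build _ _ _ _ (X m c1 c2) (mX m c1 c2).
pose XX m c1 c2 : {mfun (R * R)%type >-> R} := HB.pack (X m c1 c2) (mixX m c1 c2).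
pose GG : probability (R * R)%type R := (G \x G)%E.
pose W m c1 c2 : probability R R := distribution GG (XX m c1 c2).
exists W; split; last first.
  move=> m c1 c2 h F k1 k2 mF F0.
  have IW m' c1' c2' (H : R -> \bar R) : measurable_fun setT H -> (forall x, 0 <= H x)%E ->
      (\int[W m' c1' c2']_x H x = \int[G]_u \int[G]_v H (m' + c1' * u - c2' * v)%R)%E.
    move=> mH H0; rewrite /W ge0_integral_distribution// /GG.
    rewrite fubini_tonelli1//; first exact: (measurableT_comp mH (mX m' c1' c2')).
    by move=> z; exact: H0.
  rewrite IW//; last 2 first.
  - apply: emeasurable_funM => //; apply/measurable_EFinP.
    by apply: measurableT_comp => //; exact: measurable_funM.
  - by move=> x; rewrite mule_ge0// lee_fin expR_ge0.
  rewrite IW//.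
  (* The second variable is already tilted and integrated out here, while the first enters unscaled
     as u, so that its own tilt can act on [H] afterwards. *)
  pose H u := (\int[G]_v F (m + u - c2 / (1 + h * c2) * v)%R)%E.
  have mFp : measurable_fun setT (fun z : R * R => F (m + z.1 - c2 / (1 + h * c2) * z.2)).
    apply: measurableT_comp => //; apply: measurable_funB; last exact: measurable_funM.
    exact: measurable_funD.
  have mH : measurable_fun setT H.
    exact: (measurable_fun_fubini_tonelli_F (fun z : R * R => F (m + z.1 - c2 / (1 + h * c2) * z.2))).
  have H0 u : (0 <= H u)%E by exact: integral_ge0.
  have inner u : (\int[G]_v ((expR (h * (m + c1 * u - c2 * v)))%:E * F (m + c1 * u - c2 * v)%R) =
     (expR (h * m + h * c1 * u) * (1 + h * c2) `^ (- a))%:E * H (c1 * u)%R)%E.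
    have mFu : measurable_fun setT (fun v : R => F (m + c1 * u - c2 * v)).
      by apply: measurableT_comp => //; apply: measurable_funB => //; exact: measurable_funM.
    rewrite EFinM -muleA.
    have -> : H (c1 * u) = (\int[G]_v F (m + c1 * u - c2 * (v / (1 + h * c2)))%R)%E.
      by apply: eq_integral => v _; congr (F (_ - _)); rewrite mulrA mulrAC.
    rewrite -(Gscale _ (fun v => F (m + c1 * u - c2 * v)%R) k2 mFu)//.
    rewrite -ge0_integralZl//; last 2 first.
    - apply: emeasurable_funM => //; apply/measurable_EFinP.
      by apply: measurableT_comp => //; exact: measurable_funM.
    - by move=> v _; rewrite mule_ge0// lee_fin expR_ge0.
    apply: eq_integral => v _; rewrite muleA -EFinM -expRD.
    by congr ((expR _)%:E * _)%E; ring.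
  under eq_integral do rewrite inner.
  have mHc : measurable_fun setT (fun u : R => H (c1 * u)).
    by apply: measurableT_comp => //; exact: measurable_funM.
  have -> : (\int[G]_u \int[G]_v F (m + c1 / (1 - h * c1) * u - c2 / (1 + h * c2) * v)%R =
      \int[G]_u H (c1 * (u / (1 - h * c1)))%R)%E.
    by apply: eq_integral => u _; rewrite /H mulrA (mulrAC c1).
  rewrite (powRM _ (ltW k1) (ltW k2)).
  have -> : (expR (m * h) * ((1 - h * c1) `^ (- a) * (1 + h * c2) `^ (- a)) =
     expR (m * h) * (1 + h * c2) `^ (- a) * (1 - h * c1) `^ (- a))%R by ring.
  rewrite EFinM -muleA -(Gscale _ (fun u => H (c1 * u)%R) k1 mHc)//.
  rewrite -ge0_integralZl//; last 3 first.
  - apply: emeasurable_funM => //; apply/measurable_EFinP.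
    by apply: measurableT_comp => //; exact: measurable_funM.
  - by move=> u _; rewrite mule_ge0// lee_fin expR_ge0.
  - by rewrite lee_fin mulr_ge0 ?expR_ge0 ?powR_ge0.
  apply: eq_integral => u _; rewrite muleA -EFinM; congr (_%:E * _)%E.
  by rewrite [RHS]mulrAC -expRD; congr (expR _ * _); ring.
have cos1 (x : R) : `|cos x| <= 1 by rewrite ler_norml cos_geN1 cos_le1.
have ccos : measurable_fun setT (@cos R).
  by apply: continuous_measurable_fun; exact: continuous_cos.
have bint dd (TT : measurableType dd) (Q : probability TT R) (f : TT -> R) :
    measurable_fun setT f -> (forall z : TT, `|f z| <= 1) ->
    Q.-integrable setT (EFin \o f).
  move=> mf f1; apply: measurable_bounded_integrable => //.
  - by rewrite [ltLHS](_ : _ = 1%E) ?ltry//; exact: probability_setT.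
  - by exists 1; split => // M M1 x _ /=; rewrite (le_trans (f1 _))// ltW.
have maff (p q : R) : measurable_fun setT (fun u : R => p + q * u).
  by apply: measurable_funD => //; exact: measurable_funM.
have GC p q : (\int[G]_u (cos (p + q * u))%:E =
    ((1 + q ^+ 2) `^ (- (a / 2)) * cos (p + a * atan q))%:E)%E.
  rewrite -Gcos /Rintegral fineK//.
  apply: integrable_fin_num => //; apply: bint => //.
  by apply: measurableT_comp => //; exact: maff.
(* The phase [p] is carried along so that the imaginary part is the case p = - pi / 2 of the same
   computation. *)
have WC m c1 c2 p xi : (\int[W m c1 c2]_x (cos (p + xi * x))%:E =
   ((1 + (c1 * xi) ^+ 2) `^ (- (a / 2)) * (1 + (c2 * xi) ^+ 2) `^ (- (a / 2)) *
    cos (p + (m * xi + a * (atan (c1 * xi) - atan (c2 * xi)))))%:E)%E.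
  have mpz : measurable_fun setT (fun z => cos (p + xi * X m c1 c2 z)).
    apply: measurableT_comp => //; apply: measurable_funD => //.
    by apply: measurable_funM => //; exact: mX.
  have iz : GG.-integrable setT (EFin \o (fun z => cos (p + xi * X m c1 c2 z))).
    by apply: bint.
  rewrite /W integral_distribution//; last first.
    apply/measurable_EFinP; apply: measurableT_comp => //; exact: maff.
  rewrite /GG -integral12_prod_meas1//.
  transitivity (\int[G]_u ((1 + (c2 * xi) ^+ 2) `^ (- (a / 2)) *
     cos ((p + m * xi - a * atan (c2 * xi)) + (c1 * xi) * u))%:E)%E.
    apply: eq_integral => u _.
    transitivity (\int[G]_v (cos ((p + m * xi + c1 * xi * u) + - (c2 * xi) * v))%:E)%E.
      apply: eq_integral => v _ /=; congr (cos _)%:E.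
      by rewrite /X/=; ring.
    rewrite GC sqrrN atanN; congr (_ * cos _)%:E; ring.
  under eq_integral do rewrite EFinM.
  rewrite integralZl//; last first.
    by apply: bint => //; apply: measurableT_comp => //; exact: maff.
  rewrite GC -EFinM; congr EFin; rewrite mulrCA mulrA; congr (_ * cos _); ring.
move=> m c1 c2 xi rho phi; rewrite /charfun; congr Complex.
  rewrite /Rintegral.
  under eq_integral => x _ do rewrite -[xi * x]add0r.
  by rewrite WC/= add0r.
rewrite /Rintegral.
under eq_integral => x _ do rewrite -cosBpihalf addrC.
by rewrite WC/= -[sin phi]cosBpihalf [phi - _]addrC.
Qed.

(** The number [q] is the quadratic with roots h1 and h2, hence positive between them. Uniqueness of
    characteristic functions replaces [V] by the explicit Gamma difference, where the tilt is a
    rescaling. *)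
Lemma VG_law_esscher m d s a c h (V : probability R R) :
  VG_law m d s a c V -> vg_h1 d s c < h -> h < vg_h2 d s c ->
  let q := 1 - 2^-1 * c * s ^+ 2 * h ^+ 2 - d * c * h in
  0 < q /\ exists2 W : probability R R,
    VG_law m (d + h * s ^+ 2) s a (c / q) W &
    forall F : R -> \bar R, measurable_fun setT F -> (forall x, 0 <= F x)%E ->
    (\int[V]_x ((expR (h * x))%:E * F x) =
     (expR (m * h) / q `^ a)%:E * \int[W]_x F x)%E.
Proof.
case=> s0 a0 c0 VE h1h hh2 q; move: h1h hh2; rewrite /vg_h1 /vg_h2.
set D := Num.sqrt _; set g := d / s ^+ 2 => h1h hh2.
have s20 : 0 < s ^+ 2 by rewrite exprn_gt0.
have DE : D ^+ 2 = g ^+ 2 + 2 / (c * s ^+ 2).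
  rewrite /D sqr_sqrtr.
    by rewrite /g expr_div_n -exprM.
  by rewrite addr_ge0// divr_ge0 ?sqr_ge0 ?exprn_ge0 ?mulr_ge0 ?(ltW s20) ?(ltW s0) ?(ltW c0).
have k0 : 0 < 2 / (c * s ^+ 2) by rewrite divr_gt0 ?mulr_gt0.
have D0 : 0 <= D by exact: sqrtr_ge0.
(* This says that the two roots have opposite signs, so that [c1] and [c2] are both positive. *)
have gD : `|g| < D.
  by rewrite -(ltr_pXn2r (n := 2)) ?nnegrE// real_normK ?num_real// DE ltrDl.
move: gD; rewrite ltr_norml => /andP[gD1 gD2].
pose h1 := - g - D; pose h2 := - g + D.
have h10 : h1 < 0 by rewrite /h1; lra.
have h20 : 0 < h2 by rewrite /h2; lra.
have h12 : h1 * h2 = - (2 / (c * s ^+ 2)).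
  have -> : h1 * h2 = g ^+ 2 - D ^+ 2 by rewrite /h1 /h2; ring.
  by rewrite DE opprD addNKr.
pose c1 := h2^-1; pose c2 := - h1^-1.
have c10 : 0 < c1 by rewrite invr_gt0.
have c20 : 0 < c2 by rewrite oppr_gt0 invr_lt0.
have cc : c1 * c2 = 2^-1 * s ^+ 2 * c.
  have -> : c1 * c2 = - (h1 * h2)^-1.
    by rewrite /c1 /c2 invfM; ring.
  by rewrite h12 invrN opprK; field; rewrite !gt_eqF.
have cd : c1 - c2 = d * c.
  have -> : c1 - c2 = - (h1 + h2) * (c1 * c2).
    by rewrite /c1 /c2; field; rewrite lt_eqF// gt_eqF.
  have -> : h1 + h2 = - (2 * g) by rewrite /h1 /h2; ring.
  by rewrite cc /g; field; rewrite gt_eqF.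
have k1 : 0 < 1 - h * c1 by rewrite subr_gt0 ltr_pdivrMr// mul1r.
have k2 : 0 < 1 + h * c2.
  by rewrite mulrN subr_gt0 ltr_ndivrMr// mul1r.
clearbody c1 c2.
have qE : q = (1 - h * c1) * (1 + h * c2).
  transitivity (1 - h * (c1 - c2) - h ^+ 2 * (c1 * c2)); last by ring.
  by rewrite cd cc /q; ring.
have q0 : 0 < q by rewrite qE mulr_gt0.
split=> //; have [W [Wchar Wtilt]] := gamma_difference_law a0.
exists (W m (c1 / (1 - h * c1)) (c2 / (1 + h * c2))).
  split=> //; first by rewrite divr_gt0.
  move=> xi; rewrite Wchar.
  rewrite (@vg_charfunE _ _ _ _ _ (c1 / (1 - h * c1)) (c2 / (1 + h * c2)))//.
  - by rewrite divr_gt0.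
  - by rewrite divr_gt0.
  (* The new difference of scales is (c1 - c2 + 2 h c1 c2) / q = (d + h s^2) (c / q): this is where
     the shift of the drift parameter by h s^2 comes from. *)
  - transitivity ((c1 - c2 + 2 * h * (c1 * c2)) / q).
      by rewrite qE; field; rewrite !gt_eqF.
    by rewrite cd cc; field; rewrite gt_eqF.
  - transitivity (c1 * c2 / q).
      by rewrite qE; field; rewrite !gt_eqF.
    by rewrite cc -mulrA.
move=> F mF F0.
rewrite (eq_measure_integral (W m c1 c2)).
  by rewrite Wtilt// qE powRN.
move=> A mA _; apply: charfun_inj => // xi.
by rewrite VE Wchar; exact: vg_charfunE.
Qed.

End vg_law.

(** * Independence from the past *)

Section independence.
Context d (Omega : measurableType d) (R : realType) (P : probability Omega R).
Implicit Types (Y : R -> {RV P >-> R}).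
Local Open Scope ereal_scope.

(** Both E -> P (E [&] D) and E -> P E * P D are finite measures, so agreement on a generating
    pi-system containing the whole space is enough. *)
Lemma g_sigma_algebra_independent (G : set (set Omega)) (D : set Omega) :
  G `<=` measurable -> setI_closed G -> G setT -> measurable D ->
  (forall E, G E -> P (E `&` D) = P E * P D) ->
  forall E, <<s G >> E -> P (E `&` D) = P E * P D.
Proof.
move=> mG GI GT mD GD E GE.
have PD0 : (0 <= fine (P D))%R by exact: fine_ge0.
pose m2 : {measure set Omega -> \bar R} := mscale (NngNum PD0) P.
have PDE : (fine (P D))%:E = P D by rewrite fineK// fin_num_measure.
transitivity (m2 E); last first.
  by rewrite [LHS](_ : _ = (fine (P D))%:E * P E)// PDE muleC.
rewrite -[LHS]/(mrestr P mD E).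
apply: (g_sigma_algebra_measure_unique G mG (fun=> setT)) => //.
- by rewrite bigcup_const.
- by move=> A GA; rewrite [RHS](_ : _ = (fine (P D))%:E * P A)// PDE muleC -GD.
- move=> _; change (P (setT `&` D) < +oo).
  by rewrite setTI -ge0_fin_numE// fin_num_measure.
Qed.

Definition cylinders (X : nat -> Omega -> R) n : set (set Omega) :=
  [set E | exists2 B : nat -> set R, forall i, measurable (B i) &
    E = [set w | forall i, (i < n)%N -> B i (X i w)]].

Lemma cylindersE (X : nat -> Omega -> R) n (B : nat -> set R) :
  [set w | forall i, (i < n)%N -> B i (X i w)] =
  \bigcap_(i : 'I_n) (X i @^-1` B i).
Proof.
apply/seteqP; split=> [w h i _|w h i ilt]; first exact: h.
exact: (h (Ordinal ilt)).
Qed.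

Lemma measurable_cylinders (X : nat -> Omega -> R) n :
  (forall i, measurable_fun setT (X i)) -> cylinders X n `<=` measurable.
Proof.
move=> mX _ [B mB ->]; rewrite cylindersE.
apply: fin_bigcap_measurable => [|i _]; first exact: finite_finset.
by rewrite -[X in measurable X]setTI; exact: mX.
Qed.

Lemma setI_closed_cylinders (X : nat -> Omega -> R) n :
  setI_closed (cylinders X n).
Proof.
move=> _ _ [A mA ->] [B mB ->]; exists (fun i => A i `&` B i).
  by move=> i; exact: measurableI.
apply/seteqP; split=> [w [h1 h2] i ilt|w h]; first by split; [exact: h1|exact: h2].
by split=> i ilt; have [] := h i ilt.
Qed.

Lemma cylindersT (X : nat -> Omega -> R) n : cylinders X n setT.
Proof. by exists (fun=> setT) => //; apply/seteqP; split. Qed.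

(** Mutual independence gives the product formula on cylinders in the first n coordinates, and these
    form a pi-system. *)
Lemma cylinders_independent (X : nat -> Omega -> R) n (C : set R) E :
  (forall i, measurable_fun setT (X i)) ->
  mutually_independent P (fun i : 'I_n.+1 => X i) ->
  measurable C -> <<s cylinders X n >> E ->
  P (E `&` X n @^-1` C) = P E * P (X n @^-1` C).
Proof.
move=> mX ind mC; apply: g_sigma_algebra_independent.
- exact: measurable_cylinders.
- exact: setI_closed_cylinders.
- exact: cylindersT.
- by rewrite -[X in measurable X]setTI; exact: mX.
move=> _ [B mB ->].
(* The last slot is left free: D = C gives the joint probability, D = [setT] the probability of the
   cylinder alone. *)
pose A (D : set R) (i : nat) : set R := if (i < n)%N then B i else D.
have mA D : measurable D -> forall i, measurable (A D i).
  by move=> mD i; rewrite /A; case: ifP.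
have indA D : measurable D ->
    P ([set w | forall i, (i < n)%N -> B i (X i w)] `&` X n @^-1` D) =
    (\prod_(i < n) P (X i @^-1` B i)) * P (X n @^-1` D).
  move=> mD; transitivity (P (\bigcap_(i : 'I_n.+1) (X i @^-1` A D i))).
    congr (P _); apply/seteqP; split=> [w [h1 h2] i _ /=|w h].
      rewrite /A; case: ifPn => [/h1//|]; rewrite -leqNgt => ni.
      by have -> : (i : nat) = n by apply/eqP; rewrite eqn_leq ni -ltnS ltn_ord.
    split=> [i ilt|]; last by have := h ord_max I; rewrite /= /A ltnn.
    by have := h (widen_ord (leqnSn n) (Ordinal ilt)) I; rewrite /= /A ilt.
  rewrite (ind _ (fun i => mA D mD i)) big_ord_recr/=; congr (_ * _).
    by apply: eq_bigr => i _; rewrite /A ltn_ord.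
  by rewrite /A ltnn.
rewrite indA// -[X in _ = P X * _]setIT; congr (_ * _).
have := indA setT measurableT; rewrite preimage_setT probability_setT mule1.
by move=> ->.
Qed.

(** Telescoping: Y (s k) - Y (s 0) is the sum of the first k increments, each measurable for the
    generated sigma-algebra. *)
Lemma cylinders_sum_increments Y (s : nat -> R) n k (B : set R) :
  (k <= n)%N -> measurable B ->
  <<s cylinders (fun i w => Y (s i.+1) w - Y (s i) w)%R n >>
    [set w | B (Y (s k) w - Y (s 0%N) w)%R].
Proof.
move=> kn mB; set G := cylinders _ _.
pose OG := g_sigma_algebraType G.
suff mk : measurable_fun (setT : set OG) (fun w : OG => Y (s k) w - Y (s 0%N) w)%R.
  have := mk measurableT _ mB; rewrite setTI; exact.
elim: k kn => [_|k ih kn].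
  rewrite (_ : (fun _ => _) = cst 0%R); first exact: measurable_cst.
  by apply/funext => w; rewrite subrr.
rewrite (_ : (fun _ => _) = (fun w : OG =>
    (Y (s k.+1) w - Y (s k) w) + (Y (s k) w - Y (s 0%N) w)))%R; last first.
  by apply/funext => w; rewrite addrA subrK.
apply: measurable_funD; last by apply: ih; exact: ltnW.
move=> _ A mA; rewrite setTI; apply: sub_sigma_algebra.
exists (fun i => if i == k then A else setT); first by move=> i; case: ifP.
apply/seteqP; split=> [w h i ilt|w h].
  by case: eqP => // ->.
by have := h k kn; rewrite eqxx.
Qed.

Lemma probability_setI_ae (N E : set Omega) : measurable N -> P N = 1 ->
  measurable E -> P E = P (E `&` N).
Proof.
move=> mN N1 mE.
have N0 : P (~` N) = 0 by rewrite probability_setC// N1 subee.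
rewrite -[in LHS](setIT E) -(setUv N) setIUr measureU//; last 3 first.
- exact: measurableI.
- by apply: measurableI => //; exact: measurableC.
- by rewrite setIACA setICr setI0.
rewrite [X in _ + X](_ : _ = 0) ?adde0//.
apply/eqP; rewrite -measure_le0 -N0; apply: le_measure; rewrite ?inE//.
- by apply: measurableI => //; exact: measurableC.
- exact: measurableC.
Qed.

Lemma probability_eq0_ae (X : {RV P >-> R}) :
  {ae P, forall w, X w = 0%R} -> P (X @^-1` [set 0%R]) = 1.
Proof.
move=> [M [mM M0 sM]].
have mN : measurable (X @^-1` [set 0%R]).
  by rewrite -[Y in measurable Y]setTI; exact: (measurable_funPT X).
have NC0 : P (~` (X @^-1` [set 0%R])) = 0.
  apply/eqP; rewrite -measure_le0 -M0; apply: le_measure; rewrite ?inE//.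
  exact: measurableC.
by have := probability_setC P (measurableC mN); rewrite setCK NC0 sube0.
Qed.

(** The Borel set is attached to the time, not to the position in the list. Repeated times are thus
    harmless, and intersecting two cylinders only concatenates the lists. *)
Definition time_cylinders Y (t : R) : set (set Omega) :=
  [set E | exists l : seq R, exists B : R -> set R,
    [/\ {in l, forall x, 0 <= x <= t}%R, forall x, measurable (B x) &
     E = [set w | {in l, forall x, B x (Y x w)}]]].

(** Kept general in [M] to serve twice: for the ambient measurable sets and for the sigma-algebra
    generated by finitely many increments. *)
Lemma measurable_seq_cylinder (X : R -> Omega -> R) (l : seq R) (B : R -> set R)
    (M : set (set Omega)) : M setT -> setI_closed M ->
  {in l, forall x, M [set w | B x (X x w)]} ->
  M [set w | {in l, forall x, B x (X x w)}].
Proof.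
move=> MT MI; elim: l => [_|x l ih h].
  by rewrite (_ : mkset _ = setT)//; apply/seteqP; split.
rewrite (_ : mkset _ = [set w | B x (X x w)] `&`
    [set w | {in l, forall x, B x (X x w)}]).
  apply: MI; first by apply: h; rewrite inE eqxx.
  by apply: ih => y yl; apply: h; rewrite inE yl orbT.
apply/seteqP; split=> [w h1|w [h1 h2] y].
  by split; [apply: h1; rewrite inE eqxx|move=> y yl; apply: h1; rewrite inE yl orbT].
by rewrite inE => /predU1P[->//|/h2].
Qed.

Lemma measurable_time_cylinders Y t : time_cylinders Y t `<=` measurable.
Proof.
move=> _ [l [B [_ mB ->]]].
apply: (@measurable_seq_cylinder _ _ _ measurable) => //.
  by move=> A1 A2; exact: measurableI.
move=> x _; rewrite -[X in measurable X]setTI.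
exact: (measurable_funPT (Y x)).
Qed.

Lemma setI_closed_time_cylinders Y t : setI_closed (time_cylinders Y t).
Proof.
move=> _ _ [l1 [B1 [h1 m1 ->]]] [l2 [B2 [h2 m2 ->]]].
exists (l1 ++ l2); exists (fun x => (if x \in l1 then B1 x else setT) `&`
  (if x \in l2 then B2 x else setT)); split.
- by move=> x; rewrite mem_cat => /orP[/h1|/h2].
- by move=> x; apply: measurableI; case: ifP.
- apply/seteqP; split=> [w [g1 g2] x|w g].
    by rewrite mem_cat => xl; split; case: ifPn => //; [exact: g1|exact: g2].
  split=> x xl.
    by have /(_ (_ : x \in l1 ++ l2)) := g x; rewrite mem_cat xl => /(_ isT) [].
  by have /(_ (_ : x \in l1 ++ l2)) := g x; rewrite mem_cat xl orbT => /(_ isT) [].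
Qed.

Lemma natural_filtration_sub Y t :
  natural_filtration Y t `<=` <<s time_cylinders Y t >>.
Proof.
apply: smallest_sub; first exact: smallest_sigma_algebra.
move=> E [s /= st [B mB <-]]; apply: sub_sigma_algebra.
exists [:: s]; exists (fun=> B); split => //.
  by move=> x; rewrite inE => /eqP ->.
rewrite setTI; apply/seteqP; split=> [w h x|w h].
  by rewrite inE => /eqP ->.
by apply: h; rewrite inE.
Qed.

Lemma natural_filtration_measurable Y t : natural_filtration Y t `<=` measurable.
Proof.
move=> E /natural_filtration_sub; apply: smallest_sub; last exact: measurable_time_cylinders.
exact: sigma_algebra_measurable.
Qed.

Lemma natural_filtration_preimage Y t s (B : set R) : (0 <= s <= t)%R ->
  measurable B -> natural_filtration Y t (Y s @^-1` B).
Proof.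
move=> st mB; apply: sub_sigma_algebra; exists s => //.
by exists B => //; rewrite setTI.
Qed.

(** Independence of increments concerns consecutive times, while the past is described by values of
    [Y]. On the almost sure event Y 0 = 0 these values are sums of increments, and a refined time
    grid makes the future increment the next one. *)
Lemma natural_filtration_independent Y (t T : R) (A : set Omega) (C : set R) :
  levy_process Y -> (0 <= t)%R -> (t < T)%R ->
  natural_filtration Y t A -> measurable C ->
  P (A `&` [set w | C (Y T w - Y t w)%R]) =
  P A * P [set w | C (Y T w - Y t w)%R].
Proof.
move=> [Y0 indep _ _] t0 tT /natural_filtration_sub FA mC.
pose D := [set w | C (Y T w - Y t w)%R].
have mYB s (B : set R) : measurable B -> measurable (Y s @^-1` B).
  by move=> mB; rewrite -[X in measurable X]setTI; exact: (measurable_funPT (Y s)).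
have mYY s u (B : set R) : measurable B -> measurable [set w | B (Y u w - Y s w)%R].
  move=> mB; rewrite -[X in measurable X]setTI.
  exact: (measurable_funB (measurable_funPT (Y u)) (measurable_funPT (Y s))).
have mD : measurable D by exact: mYY.
pose N := Y 0%R @^-1` [set 0%R].
have mN : measurable N by exact: mYB.
have N1 : P N = 1 by exact: probability_eq0_ae.
move: A FA; apply: g_sigma_algebra_independent => //.
- exact: measurable_time_cylinders.
- exact: setI_closed_time_cylinders.
- by exists [::]; exists (fun=> setT); split => //; apply/seteqP; split.
move=> E; case=> l [B [lt mB EE]].
(* Y 0 = 0 holds only almost surely, so [E] is not itself an event about increments; [E'] is, and
   both agree on [N], which has probability 1. *)
pose E' := [set w | {in l, forall x, B x (Y x w - Y 0%R w)%R}].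
have mE : measurable E.
  by apply: (@measurable_time_cylinders Y t); exists l; exists B.
have mE' : measurable E'.
  apply: (@measurable_seq_cylinder (fun x w => Y x w - Y 0%R w)%R _ _ measurable) => //.
    by move=> A1 A2; exact: measurableI.
  by move=> x _; exact: mYY.
have EN : E `&` N = E' `&` N.
  rewrite EE /E' /N; apply/seteqP; split=> w [/= h w0]; split=> //= x xl;
  by have := h x xl; rewrite w0 subr0.
have PE : P E = P E'.
  by rewrite (probability_setI_ae mN N1 mE) EN -probability_setI_ae.
have PED : P (E `&` D) = P (E' `&` D).
  rewrite (probability_setI_ae mN N1 (measurableI _ _ mE mD)) setIAC EN setIAC.
  by rewrite -(probability_setI_ae mN N1)//; exact: measurableI.
rewrite PE PED.
(* Adding 0 lets every value be reached from the origin of the grid, and adding t makes t its last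
   point. The default value T of [nth] then supplies the grid point after t, so the increment of
   index n is exactly Y T - Y t. *)
pose u := sort <=%R (undup [:: 0%R, t & l]).
pose s i := nth T u i.
have uE x : (x \in u) = (x \in [:: 0%R, t & l]) by rewrite mem_sort mem_undup.
have u_t x : x \in u -> (0 <= x <= t)%R.
  rewrite uE !inE => /or3P[/eqP->|/eqP->|/lt//]; first by rewrite lexx.
  by rewrite lexx andbT.
have u0 : 0%R \in u by rewrite uE inE eqxx.
have ut : t \in u by rewrite uE !inE eqxx orbT.
have us : sorted <=%R u by exact: sort_le_sorted.
have us_lt : sorted <%R u by rewrite lt_sorted_uniq_le us andbT sort_uniq undup_uniq.
have usz : (0 < size u)%N by case: (u) u0.
pose n := (size u).-1.
have nE : size u = n.+1 by rewrite /n prednK.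
have s_u i : (i <= n)%N -> s i \in u by move=> i_n; rewrite mem_nth// nE ltnS.
have s_mono i j : (i <= j <= n)%N -> (s i <= s j)%R.
  move=> /andP[ij jn]; apply: (sorted_leq_nth le_trans le_refl) => //; rewrite inE nE ltnS//.
  exact: leq_trans jn.
have s_index x : x \in u -> exists2 i, (i <= n)%N & s i = x.
  move=> xu; exists (index x u); last exact: nth_index.
  by rewrite -ltnS -nE index_mem.
have s0 : s 0%N = 0%R.
  have [i i_n si] := s_index _ u0.
  apply/eqP; rewrite eq_le -{1}si s_mono//=.
  by have /andP[] := u_t _ (s_u 0%N (leq0n n)).
have sn : s n = t.
  have [i i_n si] := s_index _ ut.
  apply/eqP; rewrite eq_le -{2}si s_mono ?i_n ?leqnn// andbT.
  by have /andP[] := u_t _ (s_u n (leqnn n)).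
have sn1 : s n.+1 = T by rewrite /s nth_default// nE.
have s_lt i : (i < n.+1)%N -> (s i < s i.+1)%R.
  rewrite ltnS leq_eqVlt => /predU1P[->|i_n]; first by rewrite sn sn1.
  have /(sortedP T) := us_lt; apply; first by rewrite nE ltnS.
have s00 : (0 <= s 0%N)%R by rewrite s0.
have ind := indep n.+1 s s00 s_lt.
pose X (i : nat) (w : Omega) := (Y (s i.+1) w - Y (s i) w)%R.
have mX i : measurable_fun setT (X i).
  exact: (measurable_funB (measurable_funPT (Y _)) (measurable_funPT (Y _))).
rewrite -/D.
have -> : D = X n @^-1` C by rewrite /D /X sn sn1.
apply: cylinders_independent => //.
apply: (@measurable_seq_cylinder (fun x w => Y x w - Y 0%R w)%R).
- exact: (@measurableT _ (g_sigma_algebraType (cylinders X n))).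
- by move=> A1 A2; exact: (@measurableI _ (g_sigma_algebraType (cylinders X n))).
- move=> x xl; have xu : x \in u by rewrite uE !inE xl !orbT.
  have [k kn <-] := s_index _ xu.
  by rewrite -{1}s0; exact: cylinders_sum_increments.
Qed.


(** Stationarity compares with Y (T - t) - Y 0, and Y 0 = 0 almost surely removes the last term. *)
Lemma increment_law Y (t T : R) (C : set R) : levy_process Y ->
  (0 <= t)%R -> (t < T)%R -> measurable C ->
  P [set w | C (Y T w - Y t w)%R] = P (Y (T - t)%R @^-1` C).
Proof.
move=> [Y0 _ stat _] t0 tT mC; rewrite stat//.
have N1 := probability_eq0_ae Y0.
have mN : measurable (Y 0%R @^-1` [set 0%R]).
  by rewrite -[X in measurable X]setTI; exact: (measurable_funPT (Y 0%R)).
rewrite (probability_setI_ae mN N1); last first.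
  rewrite -[X in measurable X]setTI.
  exact: (measurable_funB (measurable_funPT (Y _)) (measurable_funPT (Y _))).
rewrite [RHS](probability_setI_ae mN N1); last first.
  by rewrite -[X in measurable X]setTI; exact: (measurable_funPT (Y _)).
congr (P _); apply/seteqP; split=> w [/= h w0]; split=> //=; move: h;
by rewrite w0 subr0.
Qed.

(** Under [P] restricted to [A], the pair (Y t, Y T - Y t) has a product law, whose second factor is
    the law of Y (T - t). Taking arbitrary past events [A] makes this the form in which conditional
    expectations are tested. *)
Lemma filtration_fubini Y (t T : R) (A : set Omega) (g : R * R -> \bar R) :
  levy_process Y -> (0 <= t)%R -> (t < T)%R -> natural_filtration Y t A ->
  measurable_fun setT g -> (forall z, 0 <= g z) ->
  \int[P]_(w in A) g (Y t w, Y T w - Y t w)%R =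
  \int[P]_(w in A) \int[distribution P (Y (T - t)%R)]_x g (Y t w, x).
Proof.
move=> levy t0 tT FA mg g0.
have mA := natural_filtration_measurable FA.
pose PA := mrestr P mA.
pose m2 := distribution P (Y (T - t)%R).
have intA (f : Omega -> \bar R) : measurable_fun setT f -> (forall w, 0 <= f w) ->
    \int[P]_(w in A) f w = \int[PA]_w f w.
  move=> mf f0; rewrite (@ge0_integral_density _ _ _ P PA (\1_A) f setT)//.
  - by rewrite [LHS]integral_mkcond; apply: eq_integral => w _; rewrite epatch_indic.
  - by move=> B mB; rewrite integral_indic// setIC.
have mYt : measurable_fun setT (Y t) by exact: measurable_funPT.
have mZ : measurable_fun setT (fun w => Y T w - Y t w)%R.
  exact: (measurable_funB (measurable_funPT (Y _)) (measurable_funPT (Y _))).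
pose phi w := (Y t w, Y T w - Y t w)%R.
have mphi : measurable_fun setT phi by exact: measurable_fun_pair.
have mYtB (B : set R) : measurable B -> measurable (Y t @^-1` B).
  by move=> mB; rewrite -[X in measurable X]setTI; exact: mYt.
pose m1_ : {measure set R -> \bar R} := pushforward PA (Y t).
pose m1 := m1_ mYt.
pose m'_ : {measure set (R * R) -> \bar R} := pushforward PA phi.
pose m' := m'_ mphi.
have fin1 : fin_num_fun m1.
  move=> B mB; rewrite /m1 /m1_/= /pushforward /PA /mrestr fin_num_measure//.
  by apply: measurableI => //; exact: mYtB.
pose mfin := Measure_isFinite.Build _ _ _ m1 fin1.
pose fm1 : {finite_measure set R -> \bar R} := HB.pack (Measure.sort m1) mfin.
have prodE : forall B, measurable B -> (fm1 \x m2) B = m' B.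
  (* On a rectangle B x C, the event [A] together with Y t in B still belongs to the past, so
     independence splits off the increment. *)
  apply: product_measure_unique => B C mB mC.
  rewrite /m' /m'_ /fm1 /m1 /m1_ /m2 /= /distribution /pushforward /PA /mrestr.
  rewrite -(increment_law levy t0 tT mC).
  rewrite -(natural_filtration_independent levy t0 tT _ mC).
    by congr (P _); apply/seteqP; split=> w /=; rewrite /phi/=; tauto.
  apply: (@measurableI _ (g_sigma_algebraType _)) => //.
  by apply: natural_filtration_preimage => //; rewrite t0 lexx.
rewrite (intA (fun w => g (phi w)))//; last exact: measurableT_comp.
have mG : measurable_fun setT (fun y => \int[m2]_x g (y, x)).
  exact: measurable_fun_fubini_tonelli_F.
rewrite (intA (fun w => \int[m2]_x g (Y t w, x)))//; last 2 first.
- exact: (measurableT_comp mG).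
- by move=> w; apply: integral_ge0.
transitivity (\int[m']_z g z); first by rewrite ge0_integral_pushforward.
transitivity (\int[fm1 \x m2]_z g z).
  by apply: eq_measure_integral => B mB _; rewrite -prodE.
rewrite fubini_tonelli1// /fubini_F.
transitivity (\int[m1]_y \int[m2]_x g (y, x)); first by [].
rewrite ge0_integral_pushforward// => y _; exact: integral_ge0.
Qed.

End independence.

(** * The call price *)

Section esscher_vg.
Context (R : realType) (mu delta sigma alpha theta : R).
Notation leb := (@lebesgue_measure R).
Notation h1 := (vg_h1 delta sigma theta).
Notation h2 := (vg_h2 delta sigma theta).
Notation M := (vg_mgf mu delta sigma alpha theta).
Notation q h := (1 - 2^-1 * theta * sigma ^+ 2 * h ^+ 2 - delta * theta * h).

(** The tilting identity applied to the indicator of ]-oo, x] and rewritten with the density [f]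
    identifies the Esscher distribution function with that of the tilted Variance-Gamma law. *)
Lemma VG_esscher_law (f : R -> R -> R) (V : probability R R) (u h : R) :
  VG_law (u * mu) delta sigma (u * alpha) theta V ->
  measurable_fun setT (f ^~ u) -> (forall x, 0 <= f x u) ->
  (forall A, measurable A -> V A = (\int[leb]_(x in A) (f x u)%:E)%E) ->
  h1 < h -> h < h2 ->
  [/\ 0 < q h, 0 < M h u & exists W : probability R R,
  [/\ VG_law (u * mu) (delta + h * sigma ^+ 2) sigma (u * alpha) (theta / q h) W,
      forall x : R,
        W `]-oo, x]%classic =
          (esscher_cdf mu delta sigma alpha theta f x u h)%:E &
      forall F : R -> \bar R, measurable_fun setT F -> (forall x, 0 <= F x)%E ->
        (\int[V]_x ((expR (h * x))%:E * F x) =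
         (M h u)%:E * \int[W]_x F x)%E]].
Proof.
move=> VG mf f0 Vf hh1 hh2.
have [q0 [W WVG WE]] := VG_law_esscher VG hh1 hh2.
have M0 : 0 < M h u by rewrite /vg_mgf divr_gt0 ?expR_gt0 ?powR_gt0.
have VME (F : R -> \bar R) : measurable_fun setT F -> (forall x, 0 <= F x)%E ->
    (\int[V]_x ((expR (h * x))%:E * F x) = (M h u)%:E * \int[W]_x F x)%E.
  by move=> mF F0; rewrite WE.
split=> //; exists W; split=> // x.
pose I : set R := `]-oo, x]%classic.
have mI : measurable I by exact: measurable_itv.
have mI1 : measurable_fun setT (fun y => (\1_I y)%:E : \bar R).
  by apply/measurable_EFinP; exact: measurable_indic.
have VI : (\int[V]_x0 ((expR (h * x0))%:E * (\1_I x0)%:E) = (M h u)%:E * W I)%E.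
  by rewrite VME// integral_indic// setIT.
have mexp : measurable_fun setT (fun y : R => (expR (h * y))%:E).
  by apply/measurable_EFinP; apply: measurableT_comp => //; exact: measurable_funM.
have mF := emeasurable_funM mexp mI1.
have F0 y : (0 <= (expR (h * y))%:E * (\1_I y)%:E)%E.
  by rewrite mule_ge0 ?lee_fin ?expR_ge0.
rewrite (ge0_integral_lebesgue_density mf f0 Vf measurableT mF F0) in VI.
have mFf : measurable_fun setT (fun y => (expR (h * y))%:E * (\1_I y)%:E * (f y u)%:E)%E.
  by apply: emeasurable_funM => //; exact/measurable_EFinP.
have Ff0 y : (0 <= (expR (h * y))%:E * (\1_I y)%:E * (f y u)%:E)%E.
  by rewrite mule_ge0 ?lee_fin.
have Mi0 : (0 <= (M h u)^-1%:E)%E by rewrite lee_fin invr_ge0 ltW.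
have -> : W I = ((M h u)^-1%:E * \int[leb]_y ((expR (h * y))%:E * (\1_I y)%:E * (f y u)%:E))%E.
  by rewrite VI muleA -EFinM mulVf ?mul1e// gt_eqF.
have /= ZE := ge0_integralZl leb measurableT mFf (fun y _ => Ff0 y) Mi0.
rewrite -ZE.
have IE : (\int[leb]_y ((M h u)^-1%:E * ((expR (h * y))%:E * (\1_I y)%:E * (f y u)%:E)) =
    \int[leb]_(y in I) (esscher_density mu delta sigma alpha theta f y u h)%:E)%E.
  rewrite [RHS]integral_mkcond; apply: eq_integral => y _.
  rewrite patchE indicE /esscher_density; case: ifPn => _.
    by rewrite mule1 -!EFinM; congr EFin; rewrite mulrC.
  by rewrite mule0 mul0e mule0.
rewrite IE /esscher_cdf /Rintegral fineK// -IE.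
rewrite ZE.
by rewrite VI !fin_numM// fin_num_measure.
Qed.

(** At time 1 the equation reads e^mu (q h / q (h + 1))^alpha = e^r. Logarithms give the quotient,
    and raising to the power u extends the relation from time 1 to every u. *)
Lemma vg_mgf_ratio (r h : R) : 0 < alpha -> 0 < q h -> 0 < q (h + 1) ->
  M (h + 1) 1 / M h 1 = expR r ->
  q h / q (h + 1) = expR ((r - mu) / alpha) /\
  forall u, M (h + 1) u = expR (r * u) * M h u.
Proof.
move=> a0; rewrite /vg_mgf !mul1r.
move: (q h) (q (h + 1)) => p p' p0 p'0 hr.
have lnE : ln (p / p') = (r - mu) / alpha.
  apply: (mulfI (lt0r_neq0 a0)); rewrite [RHS]mulrC divfK ?gt_eqF//.
  apply: expR_inj; rewrite expRD expRN.
  have -> : expR (alpha * ln (p / p')) = (p / p') `^ alpha.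
    by rewrite /powR gt_eqF// divr_gt0.
  rewrite -hr powRM ?invr_ge0 ?ltW// -powR_inv1 ?ltW// -!powRrM mulN1r powRN.
  rewrite mulrDr mulr1 expRD; field.
  by rewrite !gt_eqF ?expR_gt0 ?powR_gt0.
have pE : p / p' = expR ((r - mu) / alpha) by rewrite -lnE lnK// posrE divr_gt0.
split=> // u.
have -> : p = p' * expR ((r - mu) / alpha).
  by rewrite -pE mulrC divfK// gt_eqF.
rewrite powRM ?expR_ge0 ?ltW// (_ : expR _ `^ (u * alpha) = expR (u * (r - mu))); last first.
  rewrite /powR gt_eqF ?expR_gt0// expRK; congr expR; field.
  by rewrite gt_eqF.
have -> : expR (u * mu * (h + 1)) = expR (r * u) * expR (u * mu * h) / expR (u * (r - mu)).
  by rewrite -expRN -!expRD; congr expR; ring.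
field; rewrite !gt_eqF ?expR_gt0 ?powR_gt0//.
Qed.

End esscher_vg.

(** * The payoff integrated against the tilted law *)

Section call.
Context (R : realType) (mu delta sigma alpha theta : R).
Notation M := (vg_mgf mu delta sigma alpha theta).

(** Here [y] stands for the known value of Y t and [x] for the independent increment up to
    expiry. *)
Definition call_payoff (S0 K y x : R) : \bar R :=
  (Num.max (S0 * expR (y + x) - K) 0)%:E.

Lemma measurable_call_payoff (S0 K : R) :
  measurable_fun setT (fun z : R * R => call_payoff S0 K z.1 z.2).
Proof.
apply/measurable_EFinP; apply: measurable_maxr => //.
apply: measurable_funB => //; apply: measurable_funM => //.
by apply: measurableT_comp => //; exact: measurable_funD.
Qed.

Lemma call_payoff_ge0 (S0 K y x : R) : (0 <= call_payoff S0 K y x)%E.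
Proof. by rewrite lee_fin le_max lexx orbT. Qed.

(** On the exercise region [J] the payoff is S0 e^y e^x - K. Under [W], the weight e^x changes the
    tilt from h to h + 1, at the cost M (h + 1) u / M h u = e^(r u); this is the source of the
    second law [W']. *)
Lemma integral_call_payoff (V W W' : probability R R) (r u h S0 K y c c' : R) :
  0 < S0 -> 0 < K -> 0 < M h u -> M (h + 1) u = expR (r * u) * M h u ->
  (forall F : R -> \bar R, measurable_fun setT F -> (forall x, 0 <= F x)%E ->
    (\int[V]_x ((expR (h * x))%:E * F x) = (M h u)%:E * \int[W]_x F x)%E) ->
  (forall F : R -> \bar R, measurable_fun setT F -> (forall x, 0 <= F x)%E ->
    (\int[V]_x ((expR ((h + 1) * x))%:E * F x) =
     (M (h + 1) u)%:E * \int[W']_x F x)%E) ->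
  W `]-oo, ln (K / (S0 * expR y))]%classic = c%:E ->
  W' `]-oo, ln (K / (S0 * expR y))]%classic = c'%:E ->
  (\int[W]_x call_payoff S0 K y x =
   (S0 * expR y * expR (r * u) * (1 - c') - K * (1 - c))%:E)%E.
Proof.
move=> S00 K0 M0 Mr VW VW' Wc Wc'.
set b := ln _ in Wc Wc' *.
have Sy0 : 0 < S0 * expR y by rewrite mulr_gt0 ?expR_gt0.
pose J : set R := `]b, +oo[%classic.
have JE : J = ~` `]-oo, b]%classic.
  apply/seteqP; split=> x; rewrite /J/= !in_itv/= ?andbT.
    by move=> bx; apply/negP; rewrite -ltNge.
  by move/negP; rewrite -ltNge.
have mJ : measurable J by exact: measurable_itv.
have tail (U : probability R R) e : U `]-oo, b]%classic = e%:E -> U J = (1 - e)%:E.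
  by move=> Ue; rewrite JE probability_setC// Ue.
have WJ := tail W _ Wc; have WJ' := tail W' _ Wc'.
have m1 : measurable_fun setT (fun x => (\1_J x)%:E : \bar R).
  by apply/measurable_EFinP; exact: measurable_indic.
have mexp : measurable_fun setT (fun x : R => (expR x)%:E) by exact/measurable_EFinP.
have expJ : (\int[W]_x ((expR x)%:E * (\1_J x)%:E) = (expR (r * u) * (1 - c'))%:E)%E.
  have mE := emeasurable_funM mexp m1.
  have E0 x : (0 <= (expR x)%:E * (\1_J x)%:E)%E.
    by rewrite mule_ge0 ?lee_fin ?expR_ge0.
  have J0 x : (0 <= (\1_J x)%:E :> \bar R)%E by rewrite lee_fin.
  have e1 := VW _ mE E0; have e2 := VW' _ m1 J0.
  have W'1 : (\int[W']_x (\1_J x)%:E = (1 - c')%:E)%E.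
    by rewrite integral_indic// setIT; exact: WJ'.
  rewrite W'1 Mr in e2.
  have e3 : ((M h u)%:E * \int[W]_x ((expR x)%:E * (\1_J x)%:E) =
      (expR (r * u) * M h u)%:E * (1 - c')%:E)%E.
    rewrite -e1 -e2; apply: eq_integral => x _.
    by rewrite muleA -EFinM -expRD mulrDl mul1r.
  have : ((M h u)^-1%:E * ((M h u)%:E * \int[W]_x ((expR x)%:E * (\1_J x)%:E)) =
      (expR (r * u) * (1 - c'))%:E)%E.
    by rewrite e3 -!EFinM; congr EFin; field; rewrite gt_eqF.
  by rewrite muleA -EFinM mulVf ?mul1e// gt_eqF.
(* Written as a sum so that all terms are nonnegative; the strike term is subtracted only after
   integration, when it is known to be finite. *)
have splitE x : (call_payoff S0 K y x + K%:E * (\1_J x)%:E =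
    (S0 * expR y)%:E * ((expR x)%:E * (\1_J x)%:E))%E.
  rewrite /call_payoff -!EFinM -EFinD; congr EFin; rewrite expRD mulrA indicE.
  have bx : (b < x) = (K < S0 * expR y * expR x).
    rewrite -ltr_expR /b lnK ?posrE ?divr_gt0// ltr_pdivrMr//.
    by rewrite [expR x * _]mulrC.
  have [xb|bx'] := ltP b x.
    rewrite mem_set ?mulr1; last by rewrite /J/= in_itv/= xb.
    by rewrite max_l ?subrK// subr_ge0 ltW// -bx.
  rewrite memNset ?mulr0; last by rewrite /J/= in_itv/= andbT; apply/negP; rewrite -leNgt.
  by rewrite max_r ?addr0// subr_le0 leNgt -bx -leNgt.
have mpay : measurable_fun setT (call_payoff S0 K y).
  exact: (measurableT_comp (measurable_call_payoff S0 K) (measurable_pair1 y)).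
have mE := emeasurable_funM mexp m1.
have E0 x : (0 <= (expR x)%:E * (\1_J x)%:E)%E.
  by rewrite mule_ge0 ?lee_fin ?expR_ge0.
have mK : measurable_fun setT (fun x => K%:E * (\1_J x)%:E)%E.
  exact: emeasurable_funM.
have J0 x : (0 <= (\1_J x)%:E :> \bar R)%E by rewrite lee_fin.
have K0' : (0 <= K%:E)%E by rewrite lee_fin ltW.
have KJ0 x : (0 <= K%:E * (\1_J x)%:E)%E by rewrite mule_ge0.
have Sy0' : (0 <= (S0 * expR y)%:E)%E by rewrite lee_fin ltW.
have total : (\int[W]_x call_payoff S0 K y x + (K * (1 - c))%:E =
    (S0 * expR y * (expR (r * u) * (1 - c')))%:E)%E.
  rewrite [in RHS]EFinM -expJ.
  have /= <- := ge0_integralZl W measurableT mE (fun x _ => E0 x) Sy0'.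
  under [RHS]eq_integral do rewrite -splitE.
  rewrite (ge0_integralD _ measurableT (fun x _ => call_payoff_ge0 S0 K y x) mpay
    (fun x _ => KJ0 x) mK).
  congr (_ + _)%E.
  have /= -> := ge0_integralZl W measurableT m1 (fun x _ => J0 x) K0'.
  by rewrite integral_indic// setIT EFinM; congr (_ * _)%E; exact/esym/WJ.
rewrite -[LHS](@addeK _ (K * (1 - c))%:E)// total -EFinB; congr EFin.
by rewrite mulrA.
Qed.

End call.

(** * The conditional expectation under the martingale measure *)

Section conditional_expectation.
Context d (Omega : measurableType d) (R : realType) (P : probability Omega R).
Context (mu delta sigma alpha theta : R) (Y : R -> {RV P >-> R}) (f : R -> R -> R).
Notation h1 := (vg_h1 delta sigma theta).
Notation h2 := (vg_h2 delta sigma theta).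
Notation M := (vg_mgf mu delta sigma alpha theta).
Notation Fhat := (esscher_cdf mu delta sigma alpha theta f).
Hypothesis VG : VG_process mu delta sigma alpha theta Y.
Hypothesis fY : forall t : R, 0 < t -> density_of (Y t) (fun x => f x t).

Lemma VG_process_esscher_law (u h : R) : 0 < u -> h1 < h -> h < h2 ->
  [/\ 0 < 1 - 2^-1 * theta * sigma ^+ 2 * h ^+ 2 - delta * theta * h,
      0 < M h u & exists W : probability R R,
  [/\ VG_law (u * mu) (delta + h * sigma ^+ 2) sigma (u * alpha)
        (theta / (1 - 2^-1 * theta * sigma ^+ 2 * h ^+ 2 - delta * theta * h)) W,
      forall x : R, W `]-oo, x]%classic = (Fhat x u h)%:E &
      forall F : R -> \bar R, measurable_fun setT F -> (forall x, 0 <= F x)%E ->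
        (\int[distribution P (Y u)]_x ((expR (h * x))%:E * F x) =
         (M h u)%:E * \int[W]_x F x)%E]].
Proof.
move=> u0 hh1 hh2; have [mf f0 fE] := fY u0.
by apply: VG_esscher_law => //; exact: VG.2.
Qed.

(** Against an event of the past, the candidate and the payoff reduce by Fubini to the same
    integral: the tilt e^(h Y T) splits into a factor known at t and one that turns the law of the
    increment into [W]. *)
Lemma call_cond_expectation (r h S0 K t T : R) :
  0 < alpha -> 0 < S0 -> 0 < K ->
  h1 < h -> h < h2 - 1 ->
  M (h + 1) 1 / M h 1 = expR r -> 0 <= t -> t < T ->
  is_cond_expectation (esscher_measure mu delta sigma alpha theta (Y T) h T)
    (natural_filtration Y t) (fun w => Num.max (S0 * expR (Y T w) - K) 0)
    (fun w => S0 * expR (Y t w) * expR (r * (T - t)) *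
      (1 - Fhat (ln (K / (S0 * expR (Y t w)))) (T - t) (h + 1)) -
      K * (1 - Fhat (ln (K / (S0 * expR (Y t w)))) (T - t) h)).
Proof.
move=> a0 S00 K0 hh1 hh2 hr t0 tT.
have levy := VG.1.
have hh2' : h < h2 by lra.
have h1h1 : h1 < h + 1 by lra.
have h1h2 : h + 1 < h2 by lra.
have tau0 : 0 < T - t by rewrite subr_gt0.
have T0 : 0 < T by exact: le_lt_trans tT.
have [q0 Mtau [W [_ Wcdf WE]]] := VG_process_esscher_law tau0 hh1 hh2'.
have [q1 _ [W' [_ Wcdf' WE']]] := VG_process_esscher_law tau0 h1h1 h1h2.
have [_ MT [WT [_ _ WTE]]] := VG_process_esscher_law T0 hh1 hh2'.
have [_ MT1 [WT1 [_ _ WTE1]]] := VG_process_esscher_law T0 h1h1 h1h2.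
have [_ Mratio] := vg_mgf_ratio a0 q0 q1 hr.
pose z (y : R) := S0 * expR y * expR (r * (T - t)) *
  (1 - Fhat (ln (K / (S0 * expR y))) (T - t) (h + 1)) -
  K * (1 - Fhat (ln (K / (S0 * expR y))) (T - t) h).
have zE y : (\int[W]_x call_payoff S0 K y x = (z y)%:E)%E.
  by rewrite (@integral_call_payoff _ mu delta sigma alpha theta _ W W' r (T - t) h _ _ _
    (Fhat (ln (K / (S0 * expR y))) (T - t) h)
    (Fhat (ln (K / (S0 * expR y))) (T - t) (h + 1)) S00 K0 Mtau (Mratio _) WE WE').
have mpay := measurable_call_payoff S0 K.
(* Measurability is read off from [zE]: an integral depending on a parameter is measurable in it by
   Tonelli, which avoids studying the distribution functions. *)
have mz : measurable_fun setT z.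
  apply/measurable_EFinP.
  have := measurable_fun_fubini_tonelli_F (m2 := W) _ mpay
    (fun p => call_payoff_ge0 S0 K p.1 p.2).
  by congr measurable_fun; apply/funext => y; exact: zE.
have z0 y : 0 <= z y.
  by rewrite -lee_fin -zE; apply: integral_ge0 => x _; exact: call_payoff_ge0.
pose dens w := expR (h * Y T w) / M h T.
have mYt s : measurable_fun setT (Y s) by exact: measurable_funPT.
have mdens : measurable_fun setT dens.
  apply: measurable_funM => //; apply: measurableT_comp => //.
  exact: measurable_funM.
have dens0 w : 0 <= dens w by rewrite divr_ge0 ?expR_ge0 ?ltW.
pose Q : {measure set Omega -> \bar R} :=
  esscher_measure mu delta sigma alpha theta (Y T) h T.
have QE (A : set Omega) (G : Omega -> \bar R) : measurable A ->
    measurable_fun setT G -> (forall w, 0 <= G w)%E ->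
    (\int[Q]_(w in A) G w = \int[P]_(w in A) (G w * (dens w)%:E))%E.
  by move=> mA mG G0; exact: (@ge0_integral_density _ _ _ P Q dens).
pose X w := Num.max (S0 * expR (Y T w) - K) 0.
pose Z w := z (Y t w).
have mX : measurable_fun setT X.
  apply: measurable_maxr => //; apply: measurable_funB => //.
  by apply: measurable_funM => //; exact: measurableT_comp.
have mZ : measurable_fun setT Z by exact: measurableT_comp.
have X0 w : 0 <= X w by rewrite /X le_max lexx orbT.
have Z0 w : 0 <= Z w by exact: z0.
have key A : natural_filtration Y t A ->
    (\int[Q]_(w in A) (Z w)%:E = \int[Q]_(w in A) (X w)%:E)%E.
  move=> FA; have mA := natural_filtration_measurable FA.
  rewrite !QE//; try (by move=> w; rewrite lee_fin); try exact/measurable_EFinP.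
  pose k (y x : R) : \bar R := (expR (h * (y + x)) / M h T)%:E.
  have mk : measurable_fun setT (fun p : R * R => k p.1 p.2).
    apply/measurable_EFinP; apply: measurable_funM => //.
    by apply: measurableT_comp => //; apply: measurable_funM => //; exact: measurable_funD.
  have k0 y x : (0 <= k y x)%E by rewrite lee_fin divr_ge0 ?expR_ge0 ?ltW.
  pose g1 (p : R * R) : \bar R := ((z p.1)%:E * k p.1 p.2)%E.
  pose g2 (p : R * R) : \bar R := (call_payoff S0 K p.1 p.2 * k p.1 p.2)%E.
  have mg1 : measurable_fun setT g1.
    apply: emeasurable_funM => //; apply/measurable_EFinP.
    exact: (measurableT_comp mz (@measurable_fst _ _ _ _)).
  have mg2 : measurable_fun setT g2 by exact: emeasurable_funM.
  have g10 p : (0 <= g1 p)%E by rewrite mule_ge0// lee_fin.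
  have g20 p : (0 <= g2 p)%E by rewrite mule_ge0// call_payoff_ge0.
  have e1 := filtration_fubini levy t0 tT FA mg1 g10.
  have e2 := filtration_fubini levy t0 tT FA mg2 g20.
  have YE w : (Y t w + (Y T w - Y t w))%R = Y T w by rewrite addrC subrK.
  transitivity (\int[P]_(w in A) g1 (Y t w, (Y T w - Y t w)%R))%E.
    by apply: eq_integral => w _; rewrite /g1 /k/= YE.
  rewrite e1; transitivity (\int[P]_(w in A) g2 (Y t w, (Y T w - Y t w)%R))%E; last first.
    by apply: eq_integral => w _; rewrite /g2 /k/call_payoff/= YE.
  rewrite e2; apply: eq_integral => w _; rewrite /g1 /g2/=.
  set y := Y t w.
  have kE x : k y x = ((expR (h * y) / M h T)%:E * (expR (h * x))%:E)%E.
    by rewrite /k mulrDr expRD -EFinM mulrAC.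
  have c0 : (0 <= (expR (h * y) / M h T)%:E)%E by rewrite lee_fin divr_ge0 ?expR_ge0 ?ltW.
  have tilt (F : R -> \bar R) : measurable_fun setT F -> (forall x, 0 <= F x)%E ->
      (\int[distribution P (Y (T - t))]_x (F x * k y x) =
       (expR (h * y) / M h T)%:E * ((M h (T - t))%:E * \int[W]_x F x))%E.
    move=> mF F0; rewrite -WE//.
    have mG : measurable_fun setT (fun x => (expR (h * x))%:E * F x)%E.
      apply: emeasurable_funM => //; apply/measurable_EFinP.
      by apply: measurableT_comp => //; exact: measurable_funM.
    have G0 x : (0 <= (expR (h * x))%:E * F x)%E by rewrite mule_ge0// lee_fin expR_ge0.
    have /= <- := ge0_integralZl (distribution P (Y (T - t))) measurableT mG (fun x _ => G0 x) c0.
    by apply: eq_integral => x _; rewrite kE muleC muleA.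
  have mpy : measurable_fun setT (fun x => call_payoff S0 K y x).
    exact: (measurableT_comp mpay (measurable_pair1 y)).
  have cz0 (x : R) : (0 <= cst (z y)%:E x)%E by rewrite lee_fin.
  (* The candidate does not depend on the increment, so it enters as a constant; both sides then
     carry the same factors, and [W] has mass 1. *)
  have tz := tilt (cst (z y)%:E) (measurable_cst _) cz0.
  have tp := tilt (call_payoff S0 K y) mpy (call_payoff_ge0 S0 K y).
  apply: (etrans tz); apply/esym; apply: (etrans tp).
  rewrite zE; congr (_ * (_ * _))%E; apply/esym.
  rewrite (integral_cst W measurableT) -[RHS]mule1; congr (_ * _)%E.
  exact: probability_setT.
have FT : natural_filtration Y t setT.
  exact: (@measurableT _ (g_sigma_algebraType _)).
(* The payoff is at most S0 e^(Y T), whose tilted expectation is a multiple of M (h + 1) T; it is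
   finite because h + 1 < h2. *)
have Xfin : (\int[Q]_w (X w)%:E < +oo)%E.
  rewrite QE//; try (by move=> w; rewrite lee_fin); last exact/measurable_EFinP.
  have c0 : (0 <= (S0 / M h T)%:E)%E by rewrite lee_fin divr_ge0 ?ltW.
  pose G (x : R) : \bar R := ((expR ((h + 1) * x))%:E * 1)%E.
  have mG : measurable_fun setT G.
    apply: emeasurable_funM => //; apply/measurable_EFinP.
    by apply: measurableT_comp => //; exact: measurable_funM.
  have G0 x : (0 <= G x)%E by rewrite mule_ge0// lee_fin expR_ge0.
  have mGY : measurable_fun setT (fun w => G (Y T w)) by exact: measurableT_comp.
  apply: (@le_lt_trans _ _ (\int[P]_w ((S0 / M h T)%:E * G (Y T w)))%E).
    apply: ge0_le_integral => //.
    - by move=> w _; rewrite mule_ge0// lee_fin.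
    - by apply: emeasurable_funM; exact/measurable_EFinP.
    - exact: emeasurable_funM.
    - move=> w _; rewrite /G mule1 -!EFinM lee_fin /dens.
      have -> : S0 / M h T * expR ((h + 1) * Y T w) =
          S0 * expR (Y T w) * (expR (h * Y T w) / M h T).
        by rewrite mulrDl mul1r expRD; field; rewrite gt_eqF.
      rewrite ler_wpM2r//; first exact: dens0.
      rewrite /X ge_max mulr_ge0 ?expR_ge0 ?(ltW S00)// andbT.
      by rewrite lerBlDr lerDl ltW.
  have /= -> := ge0_integralZl P measurableT mGY (fun w _ => G0 (Y T w)) c0.
  rewrite -(ge0_integral_distribution (Y T) mG G0) WTE1//.
  rewrite (integral_cst WT1 measurableT 1%E) mul1e.
  rewrite [X in (_ * (_ * X))%E](_ : _ = 1%E) ?mule1; last exact: probability_setT.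
  by rewrite -EFinM ltry.
have Qint (G : Omega -> R) : measurable_fun setT G -> (forall w, 0 <= G w) ->
    (\int[Q]_w (G w)%:E < +oo)%E -> Q.-integrable setT (EFin \o G).
  move=> mG G0 Gfin; apply/integrableP; split; first exact/measurable_EFinP.
  by under eq_integral do rewrite /= ger0_norm//.
split.
- exact: Qint.
- by apply: Qint => //; rewrite key.
- move=> B mB.
  have -> : Z @^-1` B = Y t @^-1` (z @^-1` B) by [].
  apply: natural_filtration_preimage; first by rewrite t0 lexx.
  by rewrite -[X in measurable X]setTI; exact: mz.
- exact: key.
Qed.

End conditional_expectation.

Theorem corollary4p2 (R : realType) (d : measure_display)
    (Omega : measurableType d) (P : probability Omega R)
    (mu delta sigma alpha theta r : R) (Y : R -> {RV P >-> R})
    (f : R -> R -> R) (S0 K T h : R) :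
  0 < sigma -> 0 < alpha -> 0 < theta ->
  VG_process mu delta sigma alpha theta Y ->
  (forall t : R, 0 < t -> density_of (Y t) (fun x => f x t)) ->
  0 < S0 -> 0 < K ->
  1 < vg_h2 delta sigma theta - vg_h1 delta sigma theta ->
  vg_h1 delta sigma theta < h -> h < vg_h2 delta sigma theta - 1 ->
  vg_mgf mu delta sigma alpha theta (h + 1) 1
    / vg_mgf mu delta sigma alpha theta h 1 = expR r ->
  let S t w := S0 * expR (Y t w) in
  let Fhat := esscher_cdf mu delta sigma alpha theta f in
  let delta' := delta + h * sigma ^+ 2 in
  let theta' :=
    theta / (1 - 2^-1 * theta * sigma ^+ 2 * h ^+ 2 - delta * theta * h) in
  forall t : R, 0 <= t -> t < T ->
  let tau := T - t in
  [/\ is_arbitrage_price mu delta sigma alpha theta Y r h t T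
        (fun w => Num.max (S T w - K) 0)
        (fun w =>
           S t w * (1 - Fhat (ln (K / S t w)) tau (h + 1))
           - K * expR (- (r * tau)) * (1 - Fhat (ln (K / S t w)) tau h)),
      exists2 V : probability R R,
        VG_law (tau * mu) delta' sigma (tau * alpha) theta' V
        & forall x : R, V `]-oo, x]%classic = (Fhat x tau h)%:E &
      exists2 V : probability R R,
        VG_law (tau * mu) (delta' + sigma ^+ 2) sigma (tau * alpha)
          (theta' * expR ((r - mu) / alpha)) V
        & forall x : R, V `]-oo, x]%classic = (Fhat x tau (h + 1))%:E].
Proof.
move=> s0 a0 th0 VG fY S00 K0 h12 hh1 hh2 hr S Fhat delta' theta' t t0 tT tau.
have hh2' : h < vg_h2 delta sigma theta by lra.
have h1h1 : vg_h1 delta sigma theta < h + 1 by lra.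
have h1h2 : h + 1 < vg_h2 delta sigma theta by lra.
have tau0 : 0 < tau by rewrite subr_gt0.
have [q0 _ [W [WVG Wcdf _]]] := VG_process_esscher_law VG fY tau0 hh1 hh2'.
have [q1 _ [W' [WVG' Wcdf' _]]] := VG_process_esscher_law VG fY tau0 h1h1 h1h2.
have [qratio _] := vg_mgf_ratio a0 q0 q1 hr.
split.
- eexists.
    exact: (call_cond_expectation VG fY a0 S00 K0 hh1 hh2 hr t0 tT).
  (* Discounting by e^(- r tau) cancels the growth factor e^(r tau) of the stock term and stays on
     the strike term. *)
  move=> w; rewrite [RHS]mulrBr; congr (_ - _); last first.
    by rewrite [RHS]mulrCA [RHS]mulrA.
  rewrite [RHS]mulrA [X in _ = X * _]mulrCA -expRD addNr expR0.
  by rewrite mulr1.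
- by exists W; [exact: WVG|exact: Wcdf].
- exists W'; last exact: Wcdf'.
  have -> : delta' + sigma ^+ 2 = delta + (h + 1) * sigma ^+ 2.
    by rewrite /delta'; ring.
  (* The scale parameter at h + 1 is theta / q (h + 1), and the martingale equation expresses it
     through theta / q h. *)
  suff -> : theta' * expR ((r - mu) / alpha) =
      theta / (1 - 2^-1 * theta * sigma ^+ 2 * (h + 1) ^+ 2 - delta * theta * (h + 1)).
    exact: WVG'.
  by rewrite -qratio /theta' [LHS]mulrA divfK// gt_eqF.
Qed.
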